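(* Let $(\mathcal{K},\prec_{\mathcal{K}})$ be a Metric Abstract Elementary Class and let $U$ be an $LS(\mathcal{K})^+$-complete ultrafilter on a set $I$. (1) If $\langle M_i:i\in I\rangle$ and $\langle N_i:i\in I\rangle$ are sequences of structures in $\mathcal{K}$ with $M_i\prec_{\mathcal{K}}N_i$ for every $i\in I$, then $\prod^d_U M_i\prec_{\mathcal{K}}\prod^d_U N_i$. (2) If $\langle M_i:i\in I\rangle$, $\langle N_i:i\in I\rangle$ are sequences of structures in $\mathcal{K}$ and $h_i:M_i\to N_i$ ($i\in I$) are $L(\mathcal{K})$-isomorphisms, then the map $h:\prod^d_U M_i\to\prod^d_U N_i$, $h((x_i)_U):=(h_i(x_i))_U$, is an $L(\mathcal{K})$-isomorphism. (3) If $\langle M_i:i\in I\rangle$, $\langle N_i:i\in I\rangle$ are sequences of structures in $\mathcal{K}$ and $h_i:M_i\to N_i$ ($i\in I$) are $\mathcal{K}$-embeddings, then the map $\prod_U h_i:\prod^d_U M_i\to\prod^d_U N_i$, $(x_i)_U\mapsto(h_i(x_i))_U$, is a $\mathcal{K}$-embedding.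
   Context: Structures are $L$-structures of continuous logic: complete metric spaces with interpretations of the symbols of $L$ (uniform continuity not required). $dc(A)$ denotes the density character of the closure of $A$. A Metric Abstract Elementary Class (MAEC) is a class $\mathcal{K}$ of such structures with a relation $\prec_{\mathcal{K}}$ such that: (1) $\mathcal{K}$, $\prec_{\mathcal{K}}$ are closed under isomorphism; (2) $\prec_{\mathcal{K}}$ is a partial order; (3) $M\prec_{\mathcal{K}}N\Rightarrow M\subseteq N$; (4) for every $\prec_{\mathcal{K}}$-increasing chain $(M_i:i<\lambda)$ the function symbols can be uniquely interpreted on the completion $\overline{\bigcup_i M_i}$ making it a member of $\mathcal{K}$, each $M_j\prec_{\mathcal{K}}\overline{\bigcup_i M_i}$, and if all $M_i\prec_{\mathcal{K}}N$ then $\overline{\bigcup_iM_i}\prec_{\mathcal{K}}N$; (5) if $M_1\subseteq M_2\prec_{\mathcal{K}}M_3$ and $M_1\prec_{\mathcal{K}}M_3$ then $M_1\prec_{\mathcal{K}}M_2$; (6) there is an infinite cardinal $LS(\mathcal{K})$ such that for $M\in\mathcal{K}$, $A\subseteq M$ there is $N\in\mathcal{K}$, $A\subseteq N\prec_{\mathcal{K}}M$, $dc(N)\le dc(A)+LS(\mathcal{K})$. A $\mathcal{K}$-embedding is an isomorphism onto a $\prec_{\mathcal{K}}$-substructure. Metric ultraproduct $\prod^d_U M_i$ (for countably complete $U$): on $\prod_i M_i$ set $d((x_i),(y_i))=\lim_U d_i(x_i,y_i)$, identify points at distance $0$, and interpret symbols of $L$ coordinatewise (predicate values as $U$-limits);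 $(x_i)_U$ denotes the class of $(x_i)$.
   Formalization: The usual convention that LS(K) is at least the size of the language L is added to the definition of MAEC; without it (1) fails if there is a measurable cardinal. The symbols of L are read as continuous (not uniformly), and structures are nonempty. *)

(* Defs.v *)
From mathcomp Require Import all_boot all_order all_algebra.
From mathcomp Require Import all_classical reals interval_inference.
From mathcomp Require Import topology normedtype.
Import Order.TTheory GRing.Theory Num.Theory.
Import numFieldNormedType.Exports.

Set Implicit Arguments.
Unset Strict Implicit.
Unset Printing Implicit Defensive.

Local Open Scope classical_set_scope.
Local Open Scope ring_scope.
Local Open Scope card_scope.

Record language := Language {
  fsym : Type;
  psym : Type;
  farity : fsym -> nat;
  parity : psym -> nat }.

(* The universe of a structure is a subset [dom] of an ambient type V, so that
   inclusion of structures is literal inclusion of sets.  The values of the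
   distance and of the symbols outside [dom] are irrelevant. *)
Record prestructure (R : realType) (L : language) (V : Type) := Prestructure {
  dom : set V;
  dist : V -> V -> R;
  finterp : forall f : fsym L, ('I_(farity f) -> V) -> V;
  pinterp : forall p : psym L, ('I_(parity p) -> V) -> R }.

Section Structures.
Variables (R : realType) (L : language).

Definition tuple_in (V : Type) (S : set V) (n : nat) (x : 'I_n -> V) : Prop :=
  forall k, S (x k).

Definition metric_on (V : Type) (S : set V) (d : V -> V -> R) : Prop :=
  [/\ forall x y, S x -> S y -> (d x y = 0 <-> x = y),
      forall x y, S x -> S y -> d x y = d y x &
      forall x y z, S x -> S y -> S z -> d x z <= d x y + d y z].

Definition complete_on (V : Type) (S : set V) (d : V -> V -> R) : Prop :=
  forall u : nat -> V, (forall n, S (u n)) ->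
    (forall e : R, 0 < e -> exists N : nat,
      forall m n, (N <= m)%N -> (N <= n)%N -> d (u m) (u n) < e) ->
    exists2 l, S l & forall e : R, 0 < e -> exists N : nat,
      forall n, (N <= n)%N -> d (u n) l < e.

Definition closure_in (V : Type) (S : set V) (d : V -> V -> R) (A : set V) :
    set V :=
  [set x | S x /\ forall e : R, 0 < e -> exists2 a, A a & d x a < e].

(* The symbols are continuous, but no modulus of uniform continuity is
   imposed. *)
Definition is_structure (V : Type) (M : prestructure R L V) : Prop :=
  [/\ dom M !=set0,
      metric_on (dom M) (dist M),
      complete_on (dom M) (dist M),
      forall f (x : 'I_(farity f) -> V), tuple_in (dom M) x ->
        dom M (finterp M x) /\
        forall e : R, 0 < e -> exists2 delta : R, 0 < delta &
          forall y, tuple_in (dom M) y ->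
            (forall k, dist M (x k) (y k) < delta) ->
            dist M (finterp M x) (finterp M y) < e &
      forall p (x : 'I_(parity p) -> V), tuple_in (dom M) x ->
        forall e : R, 0 < e -> exists2 delta : R, 0 < delta &
          forall y, tuple_in (dom M) y ->
            (forall k, dist M (x k) (y k) < delta) ->
            `|pinterp M x - pinterp M y| < e].

Definition substructure (V : Type) (M N : prestructure R L V) : Prop :=
  [/\ dom M `<=` dom N,
      forall x y, dom M x -> dom M y -> dist M x y = dist N x y,
      forall f (x : 'I_(farity f) -> V), tuple_in (dom M) x ->
        finterp M x = finterp N x &
      forall p (x : 'I_(parity p) -> V), tuple_in (dom M) x ->
        pinterp M x = pinterp N x].

(* Equality of structures: prestructures that differ only outside their common
   universe are the same structure. *)
Definition same_structure (V : Type) (M N : prestructure R L V) : Prop :=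
  substructure M N /\ substructure N M.

Definition isomorphism (V W : Type) (M : prestructure R L V)
    (N : prestructure R L W) (h : V -> W) : Prop :=
  [/\ set_bij (dom M) (dom N) h,
      forall x y, dom M x -> dom M y -> dist N (h x) (h y) = dist M x y,
      forall f (x : 'I_(farity f) -> V), tuple_in (dom M) x ->
        h (finterp M x) = finterp N (h \o x) &
      forall p (x : 'I_(parity p) -> V), tuple_in (dom M) x ->
        pinterp N (h \o x) = pinterp M x].

(* [density_set M A D]: D is a dense subset, of least cardinality, of the
   closure of A in M; the cardinality of D is dc(A). *)
Definition dense_subset (V : Type) (M : prestructure R L V) (A D : set V) :
    Prop :=
  let cl := closure_in (dom M) (dist M) in D `<=` cl A /\ cl A `<=` cl D.

Definition density_set (V : Type) (M : prestructure R L V) (A D : set V) :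
    Prop :=
  dense_subset M A D /\ forall D', dense_subset M A D' -> D #<= D'.

(* dc(B) <= dc(A) + |kappa|, for A and B subsets of the universe of M *)
Definition dc_le_add (V : Type) (M : prestructure R L V) (B A : set V)
    (kappa : Type) : Prop :=
  exists E D, [/\ density_set M B E, density_set M A D &
                  E #<= [set: (set_type D + kappa)%type]].

(* The index set of a chain, a nonzero ordinal, is given as a nonempty
   well-ordered type. *)
Definition is_chain (prec : forall V : Type,
      prestructure R L V -> prestructure R L V -> Prop)
    (V J : Type) (le : rel J) (M : J -> prestructure R L V) : Prop :=
  [/\ wochoice.well_order le, inhabited J &
      forall i j, le i j -> prec V (M i) (M j)].

(* N is a member of the class whose underlying metric space is the completion
   of the union of the M_j and which extends every M_j. *)
Definition is_completion (inK : forall V : Type, prestructure R L V -> Prop)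
    (V J : Type) (M : J -> prestructure R L V) (N : prestructure R L V) :
    Prop :=
  [/\ inK V N, forall j, substructure (M j) N &
      dom N `<=` closure_in (dom N) (dist N) (\bigcup_j dom (M j))].

End Structures.

(* The cardinal LS(K) is represented by a type.  [inK] and [prec] range over
   structures in every ambient type, and are invariant under isomorphism across
   ambient types; this includes changing the values outside the universe, and
   moving a chain to an ambient type that has room for its completion. *)
Record MAEC (R : realType) (L : language) := {
  inK : forall V : Type, prestructure R L V -> Prop;
  prec : forall V : Type, prestructure R L V -> prestructure R L V -> Prop;
  LS : Type;

  inK_structure : forall V (M : prestructure R L V), inK M -> is_structure M;
  prec_inK : forall V (M N : prestructure R L V), prec M N -> inK M /\ inK N;

  inK_iso : forall V W (M : prestructure R L V) (N : prestructure R L W) h,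
    isomorphism M N h -> inK M -> inK N;
  prec_iso : forall V W (M N : prestructure R L V)
      (M' N' : prestructure R L W) h,
    isomorphism M M' h -> isomorphism N N' h -> prec M N -> prec M' N';

  prec_refl : forall V (M : prestructure R L V), inK M -> prec M M;
  prec_trans : forall V (M N P : prestructure R L V),
    prec M N -> prec N P -> prec M P;
  prec_antisym : forall V (M N : prestructure R L V),
    prec M N -> prec N M -> same_structure M N;

  prec_sub : forall V (M N : prestructure R L V),
    prec M N -> substructure M N;

  (* (C, d) is the metric completion of the union of the chain *)
  chain_interp : forall V J (le : rel J) (M : J -> prestructure R L V)
      (C : set V) (d : V -> V -> R),
    is_chain prec le M -> metric_on C d -> complete_on C d ->
    \bigcup_i dom (M i) `<=` C ->
    C `<=` closure_in C d (\bigcup_i dom (M i)) ->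
    (forall i x y, dom (M i) x -> dom (M i) y -> d x y = dist (M i) x y) ->
    let interprets N := [/\ is_completion inK M N, dom N = C &
      forall x y, C x -> C y -> dist N x y = d x y] in
    exists2 N, interprets N & forall N', interprets N' -> same_structure N N';
  chain_prec : forall V J (le : rel J) (M : J -> prestructure R L V) N,
    is_chain prec le M -> is_completion inK M N -> forall j, prec (M j) N;
  chain_smooth : forall V J (le : rel J) (M : J -> prestructure R L V) N N',
    is_chain prec le M -> is_completion inK M N -> substructure N N' ->
    (forall i, prec (M i) N') -> prec N N';

  coherence : forall V (M1 M2 M3 : prestructure R L V),
    substructure M1 M2 -> prec M2 M3 -> prec M1 M3 -> prec M1 M2;

  LS_infinite : infinite_set [set: LS];
  (* The usual convention |L| <= LS(K).  Without it, and given a measurable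
     cardinal, classes in larger languages need not be closed under
     LS(K)^+-complete ultraproducts. *)
  LS_language : [set: (fsym L + psym L)%type] #<= [set: LS];
  downward_LS : forall V (M : prestructure R L V) (A : set V),
    inK M -> A `<=` dom M ->
    exists N, [/\ inK N, A `<=` dom N, prec N M &
                  dc_le_add M (dom N) A LS] }.

Definition K_embedding (R : realType) (L : language) (K : MAEC R L)
    (V W : Type) (M : prestructure R L V) (N : prestructure R L W)
    (h : V -> W) : Prop :=
  exists2 M', prec K M' N & isomorphism M M' h.

(* |kappa|^+-completeness *)
Definition succ_complete (kappa I : Type) (U : set_system I) : Prop :=
  forall F : set (set I), F #<= [set: kappa] -> F `<=` U ->
    U (\bigcap_(A in F) A).

Section Ultraproduct.
Variables (R : realType) (L : language) (I : Type) (U : set_system I).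

Definition seq_in (V : I -> Type) (M : forall i, prestructure R L (V i)) :
    set (forall i, V i) :=
  [set x | forall i, dom (M i) (x i)].

(* (x_i)_U *)
Definition uclass (V : I -> Type) (M : forall i, prestructure R L (V i))
    (x : forall i, V i) : set (forall i, V i) :=
  [set y | seq_in M y /\ dist (M i) (x i) (y i) @[i --> U] --> (0 : R)].

(* The operations below are computed from arbitrary representatives of the
   classes.  For a countably complete ultrafilter all the limits exist and the
   choice does not matter: see [ultra_cvg_ex], [eq_uclass], [uprod_distE],
   [uprod_finterpE] and [uprod_pinterpE]. *)
Definition uprod (V : I -> Type) (M : forall i, prestructure R L (V i)) :
    prestructure R L (set (forall i, V i)) :=
  {| dom := uclass M @` seq_in M;
     dist := fun a b => get [set r : R | exists x y,
       [/\ a x, b y & dist (M i) (x i) (y i) @[i --> U] --> r]];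
     finterp := fun f a => [set z | exists2 x : 'I_(farity f) -> forall i, V i,
       forall k, a k (x k) &
       uclass M (fun i => finterp (M i) (fun k => x k i)) z];
     pinterp := fun p a => get [set r : R |
       exists2 x : 'I_(parity p) -> forall i, V i,
       forall k, a k (x k) &
       pinterp (M i) (fun k => x k i) @[i --> U] --> r] |}.

(* The copy of uprod M inside uprod N formed by the (x_i)_U with x_i in M_i,
   for M_i a substructure of N_i *)
Definition uprod_sub (V : I -> Type) (M N : forall i, prestructure R L (V i)) :
    prestructure R L (set (forall i, V i)) :=
  {| dom := uclass N @` seq_in M;
     dist := dist (uprod N);
     finterp := finterp (uprod N);
     pinterp := pinterp (uprod N) |}.

(* H is the map (x_i)_U |-> (h_i(x_i))_U *)
Definition induced_map (V W : I -> Type)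
    (M : forall i, prestructure R L (V i))
    (N : forall i, prestructure R L (W i)) (h : forall i, V i -> W i)
    (H : set (forall i, V i) -> set (forall i, W i)) : Prop :=
  forall x, seq_in M x -> H (uclass M x) = uclass N (fun i => h i (x i)).

End Ultraproduct.

Section WellDefined.
Variables (R : realType) (L : language) (I : Type) (U : set_system I).
Variable kappa : Type.
Hypotheses (UU : UltraFilter U) (Uc : succ_complete kappa U).
Hypothesis kappa_infinite : infinite_set [set: kappa].

Lemma ultra_bigcap (F : nat -> set I) :
  (forall n, U (F n)) -> U (\bigcap_n F n).
Proof.
move=> UF; rewrite -(bigcap_image setT F id).
apply: Uc; last by move=> _ [n _ <-].
have /infiniteP nk := kappa_infinite.
exact: card_le_trans (card_image_le _ _) nk.
Qed.

Lemma ultra_cvg_eq (g : I -> R) (r : R) :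
  g i @[i --> U] --> r <-> U [set i | g i = r].
Proof.
split=> [/cvgrPdist_lt gr|gr].
  have : U (\bigcap_n [set i | `|r - g i| < n.+1%:R^-1]).
    by apply: ultra_bigcap => n; apply: gr; rewrite invr_gt0.
  apply: filterS => i /= gi; apply/esym/eqP; rewrite -subr_eq0 -normr_le0.
  apply/ler_addgt0Pr => e e0; rewrite add0r ltW//.
  have [n _ ne] := near_infty_natSinv_lt (PosNum e0).
  exact: lt_trans (gi n Logic.I) (ne n (leqnn n)).
apply/cvgrPdist_lt => e e0; apply: filterS gr => i /= ->.
by rewrite subrr normr0.
Qed.

Lemma ultra_cvg_ex (g : I -> R) : exists r : R, g i @[i --> U] --> r.
Proof.
have gU : UltraFilter (g @ U).
  split; first exact: fmap_proper_filter.
  move=> G GP gG; rewrite eqEsubset; split=> // A GA.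
  have [//|nA] := in_ultra_setVsetC (g @^-1` A) UU.
  have GnA : G (~` A) by apply: gG.
  have GF : Filter G by exact: filter_filter.
  have /filter_not_empty[] : G set0 by rewrite -(setICr A); exact: filterI.
have [[n Un]|nU] := pselect (exists n : nat, U [set i | `|g i| <= n%:R]).
  have := @segment_compact R (- n%:R) n%:R; rewrite compact_ultra => /(_ _ gU).
  case=> [|r [_ gr]]; last by exists r.
  have gn : U (g @^-1` `[- n%:R, n%:R]) by
    apply: filterS Un => i /=; rewrite ler_norml in_itv.
  exact: gn.
have : U (\bigcap_n ~` [set i | `|g i| <= n%:R]).
  apply: ultra_bigcap => n.
  have [Un|//] := in_ultra_setVsetC [set i | `|g i| <= n%:R] UU.
  by case: nU; exists n.
move=> /filter_ex[i /(_ (Num.truncn `|g i|).+1 Logic.I)].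
by case; rewrite /= ltW// truncnS_gt.
Qed.

Variables (V : I -> Type) (M : forall i, prestructure R L (V i)).
Hypothesis Mstr : forall i, is_structure (M i).

Lemma uclassP x y : seq_in M x ->
  uclass U M x y <-> seq_in M y /\ U [set i | x i = y i].
Proof.
move=> Mx; split=> -[My xy]; split=> //.
  move/ultra_cvg_eq: xy; apply: filterS => i /=.
  by have [_ [d0 _ _] _ _ _] := Mstr i; move/d0; apply.
apply/ultra_cvg_eq; apply: filterS xy => i /= xy.
by have [_ [d0 _ _] _ _ _] := Mstr i; apply/d0.
Qed.

Lemma uclass_refl x : seq_in M x -> uclass U M x x.
Proof.
by move=> Mx; apply/uclassP => //; split=> //; apply: filterS filterT.
Qed.

Lemma eq_uclass x y : seq_in M x -> seq_in M y ->
  uclass U M x = uclass U M y <->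
  dist (M i) (x i) (y i) @[i --> U] --> (0 : R).
Proof.
move=> Mx My; split=> [exy|xy].
  by have := uclass_refl My; rewrite -exy => -[].
have /(uclassP _ Mx)[_ Uxy] : uclass U M x y by [].
apply/seteqP; split=> z /uclassP => /(_ _)[]// Mz Uz; apply/uclassP => //.
all: by split=> //; apply: filterS2 Uxy Uz => i /= ->.
Qed.

Lemma uprod_distE x y (r : R) : seq_in M x -> seq_in M y ->
  dist (M i) (x i) (y i) @[i --> U] --> r ->
  dist (uprod U M) (uclass U M x) (uclass U M y) = r.
Proof.
move=> Mx My xyr; apply: get_unique.
  by exists x, y; split=> //; exact: uclass_refl.
move=> s [x' [y' [/uclassP[]// _ xx' /uclassP[]// _ yy' /ultra_cvg_eq s']]].
move/ultra_cvg_eq: xyr => r'.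
have [i [[/= ex ey] [/= es er]]] :=
  filter_ex (filterI (filterI xx' yy') (filterI s' r')).
by rewrite -es -er ex ey.
Qed.

Lemma uprod_finterpE f (x : 'I_(farity f) -> forall i, V i) :
  (forall k, seq_in M (x k)) ->
  finterp (uprod U M) (fun k => uclass U M (x k)) =
  uclass U M (fun i => finterp (M i) (fun k => x k i)).
Proof.
move=> Mx; apply/seteqP; split=> z /=; last first.
  by move=> xz; exists x => // k; exact: uclass_refl.
have fM y : (forall k, seq_in M (y k)) ->
    seq_in M (fun i => finterp (M i) (fun k : 'I_(farity f) => y k i)).
  move=> My i; have [_ _ _ Mf _] := Mstr i.
  by apply: (proj1 (Mf _ _ _)) => k; exact: My.
move=> [y xy]; have My k : seq_in M (y k) by have [] := xy k.
move=> /uclassP[|Mz yz]; first exact: fM.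
apply/uclassP; first exact: fM.
split=> //; have : U [set i | forall k, x k i = y k i].
  by apply: filter_forall => k; have /uclassP[] := xy k.
by move: yz; apply: filterS2 => i /= <- e; congr finterp; apply/funext.
Qed.

Lemma uprod_pinterpE p (x : 'I_(parity p) -> forall i, V i) (r : R) :
  (forall k, seq_in M (x k)) ->
  pinterp (M i) (fun k => x k i) @[i --> U] --> r ->
  pinterp (uprod U M) (fun k => uclass U M (x k)) = r.
Proof.
move=> Mx xr; apply: get_unique.
  by exists x => // k; exact: uclass_refl.
move=> s [y xy /ultra_cvg_eq ys]; move/ultra_cvg_eq: xr => xr.
have Uxy : U [set i | forall k, x k i = y k i].
  by apply: filter_forall => k; have /uclassP[] := xy k.
have [i [/= e [<- <-]]] := filter_ex (filterI Uxy (filterI ys xr)).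
by congr pinterp; apply/funext.
Qed.

End WellDefined.

(* Main.v *)
Require Import Defs.
From mathcomp Require Import all_boot all_order all_algebra.
From mathcomp Require Import all_classical reals interval_inference.
From mathcomp Require Import topology normedtype finmap lra.
Import Order.TTheory GRing.Theory Num.Theory.

Set Implicit Arguments.
Unset Strict Implicit.
Unset Printing Implicit Defensive.

Local Open Scope classical_set_scope.
Local Open Scope ring_scope.

(** Call a family [D i] of substructures of the [N i] small if its members have
    dense subsets enumerated by a common index type along which [U] is closed
    under intersections; by Loewenheim-Skolem, small families [D i] with
    [prec (D i) (N i)] are directed and cover the ultraproduct.  By completeness of
    [U], for almost every [i] the map sending the enumerated points of [D i] to
    their classes preserves all distances and symbols, and every element of the
    ultraproduct of the [D i] is a limit of enumerated points by the pigeonhole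
    principle.  So that ultraproduct is isomorphic to [D i], compatibly with
    inclusions of small families, and these ultraproducts form a directed system
    for [prec].  It remains to see that an abstract elementary class is closed
    under directed unions.  Index such a union monotonically by the finite subsets
    of a well-ordered set [T], and show by induction on the initial segments [S] of
    [T] that the closure of the union over the finite subsets of [S] is a least
    upper bound: limit stages are unions of chains, and the stage of [S + y], where
    [y] is the successor of [S], is the stage of [S] for the reindexing by
    [a |-> y |` a]. *)

(** * Closed and complete subsets of a metric space *)

Lemma invSn_lt (R : realType) (e : R) : 0 < e ->
  exists N : nat, forall n, (N <= n)%N -> n.+1%:R^-1 < e.
Proof.
move=> e0; have [N _ Ne] := near_infty_natSinv_lt (PosNum e0).
by exists N => n; exact: Ne.
Qed.

Section MetricClosure.
Variables (R : realType) (V : Type) (S : set V) (d : V -> V -> R).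
Hypothesis dS : metric_on S d.
Local Notation cl := (closure_in S d).

Lemma metric_onxx x : S x -> d x x = 0.
Proof. by move=> Sx; have [d0 _ _] := dS; apply/d0. Qed.

Lemma metric_onC x y : S x -> S y -> d x y = d y x.
Proof. by have [_ dC _] := dS; exact: dC. Qed.

Lemma metric_on_triangle y x z : S x -> S y -> S z -> d x z <= d x y + d y z.
Proof. by have [_ _ dt] := dS => *; exact: dt. Qed.

Lemma metric_on_ge0 x y : S x -> S y -> 0 <= d x y.
Proof.
move=> Sx Sy; have := metric_on_triangle Sx Sy Sx.
by rewrite metric_onxx// (metric_onC Sy Sx); lra.
Qed.

Lemma metric_on_eq x y : S x -> S y -> (forall e : R, 0 < e -> d x y < e) -> x = y.
Proof.
move=> Sx Sy xy; have [d0 _ _] := dS; apply/d0 => //.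
apply/eqP; rewrite eq_le metric_on_ge0// andbT.
by apply/ler_addgt0Pr => e e0; rewrite add0r ltW// xy.
Qed.

Lemma closure_in_subl A : cl A `<=` S.
Proof. by move=> x []. Qed.

Lemma subset_closure_in A : A `<=` S -> A `<=` cl A.
Proof.
move=> AS x Ax; split; first exact: AS.
by move=> e e0; exists x => //; rewrite metric_onxx//; exact: AS.
Qed.

Lemma closure_inS A B : A `<=` B -> cl A `<=` cl B.
Proof.
move=> AB x [Sx xA]; split=> // e /xA[a Aa xa].
by exists a => //; exact: AB.
Qed.

Lemma closure_in_closure A : A `<=` S -> cl (cl A) `<=` cl A.
Proof.
move=> AS x [Sx xA]; split=> // e e0.
have e20 : 0 < e / 2 by lra.
have [y [Sy /(_ _ e20)[a Aa ya]] xy] := xA _ e20.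
exists a => //; have Sa := AS _ Aa.
have := metric_on_triangle Sx Sy Sa; lra.
Qed.

Lemma closure_in_seq A x : cl A x ->
  exists2 u : nat -> V, (forall n, A (u n)) & forall n, d x (u n) < n.+1%:R^-1.
Proof.
move=> [Sx xA]; have /choice[u xu] : forall n : nat, exists a, A a /\ d x a < n.+1%:R^-1.
  move=> n; have [|a Aa xa] := xA n.+1%:R^-1; first by rewrite invr_gt0.
  by exists a.
by exists u => n; case: (xu n).
Qed.

Lemma complete_closed Z : Z `<=` S -> complete_on Z d -> cl Z `<=` Z.
Proof.
move=> ZS Zc x xZ; have Sx : S x by case: xZ.
have [u Zu xu] := closure_in_seq xZ.
have Su n : S (u n) by exact: ZS.
case: (Zc u) => // [e e0|l Zl ul].
  have e20 : 0 < e / 2 by lra.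
  have [N Ne] := invSn_lt e20; exists N => m n Nm Nn.
  have := metric_on_triangle (Su m) Sx (Su n).
  rewrite (metric_onC (Su m) Sx).
  have := lt_trans (xu m) (Ne _ Nm); have := lt_trans (xu n) (Ne _ Nn); lra.
suff -> : x = l by [].
apply: metric_on_eq => // [|e e0]; first exact: ZS.
have e20 : 0 < e / 2 by lra.
have [N Ne] := invSn_lt e20; have [N' N'e] := ul _ e20.
have n1 := leq_maxl N N'; have n2 := leq_maxr N N'.
have := metric_on_triangle Sx (Su (maxn N N')) (ZS _ Zl).
have := lt_trans (xu _) (Ne _ n1); have := N'e _ n2; lra.
Qed.

Lemma closed_complete Z :
  complete_on S d -> Z `<=` S -> cl Z `<=` Z -> complete_on Z d.
Proof.
move=> Sc ZS clZ u Zu uC; have Su n : S (u n) by exact: ZS.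
have [l Sl ul] := Sc u Su uC; exists l => //; apply: clZ; split=> // e e0.
have [N Ne] := ul _ e0; exists (u N) => //.
by rewrite metric_onC//; exact: Ne.
Qed.

End MetricClosure.

(** * Substructures carried by subsets of a fixed structure *)

Section Restriction.
Variables (R : realType) (L : language) (V : Type).
Implicit Types P Q : prestructure R L V.

(** Inside one ambient structure, substructures become subsets, and chains and directed systems
    become families of sets. *)
Definition substr_on P (Z : set V) : prestructure R L V :=
  {| dom := Z; dist := dist P; finterp := @finterp _ _ _ P;
     pinterp := @pinterp _ _ _ P |}.

Lemma metric_onS (S Z : set V) (d : V -> V -> R) :
  Z `<=` S -> metric_on S d -> metric_on Z d.
Proof.
move=> ZS [d0 dC dt]; split=> *; [apply: d0|apply: dC|apply: dt]; exact: ZS.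
Qed.

Lemma substructure_complete P Q :
  is_structure P -> substructure P Q -> complete_on (dom P) (dist Q).
Proof.
move=> [_ _ Pc _ _] [_ dE _ _] u Pu uC.
have [//|e /uC[n0 n0P]|l Pl ul] := Pc u.
  by exists n0 => m n mn nn; rewrite dE//; exact: n0P.
by exists l => // e /ul[n0 n0P]; exists n0 => n nn; rewrite -dE//; exact: n0P.
Qed.

Lemma substr_on_sub P Z W : Z `<=` W -> substructure (substr_on P Z) (substr_on P W).
Proof. by move=> ZW; split. Qed.

Lemma substr_on_structure P Z : is_structure P -> Z `<=` dom P ->
  Z !=set0 -> complete_on Z (dist P) ->
  (forall f (x : 'I_(farity f) -> V), tuple_in Z x -> Z (finterp P x)) ->
  is_structure (substr_on P Z).
Proof.
move=> [_ Pm _ Pf Pp] ZP Z0 Zc Zf; split=> //=.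
- exact: metric_onS Pm.
- move=> f x Zx; split; first exact: Zf.
  move=> e e0; have [|_ /(_ _ e0)[r r0 rP]] := Pf f x; first by move=> k; exact: ZP.
  by exists r => // y Zy; apply: rP => k; exact: ZP.
- move=> p x Zx e e0; have [|r r0 rP] := Pp p x _ e e0; first by move=> k; exact: ZP.
  by exists r => // y Zy; apply: rP => k; exact: ZP.
Qed.

End Restriction.

(** * Well-ordered relations *)

(** A [wochoice.well_order] provides a unique minimum of each nonempty predicate; totality,
    antisymmetry and transitivity come from predicates with two or three elements. *)
Lemma wo_total T (le : rel T) : wochoice.well_order le -> total le.
Proof.
move=> lewo x y; pose A : {pred T} := fun z => `[< z = x \/ z = y >].
have [|z [[/asboolP Az zA] _]] := lewo A.
  by exists x; apply/asboolP; left.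
have zx : le z x by apply: zA; apply/asboolP; left.
have zy : le z y by apply: zA; apply/asboolP; right.
by case: Az => zE; move: zx zy; rewrite zE => zx zy; rewrite ?zx ?zy ?orbT.
Qed.

Lemma wo_anti T (le : rel T) : wochoice.well_order le -> antisymmetric le.
Proof.
move=> lewo x y /andP[xy yx]; pose A : {pred T} := fun z => `[< z = x \/ z = y >].
have xx : le x x by have /orP[] := wo_total lewo x x.
have yy : le y y by have /orP[] := wo_total lewo y y.
have [|z [_ zu]] := lewo A; first by exists x; apply/asboolP; left.
rewrite -(zu x) ?(zu y)//; split; rewrite /wochoice.lower_bound.
- by apply/asboolP; right.
- by move=> w /asboolP[]->.
- by apply/asboolP; left.
- by move=> w /asboolP[]->.
Qed.

Lemma wo_trans T (le : rel T) : wochoice.well_order le -> transitive le.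
Proof.
move=> lewo y x z xy yz.
pose A : {pred T} := fun t => `[< [\/ t = x, t = y | t = z] >].
have [|t [[/asboolP At tA] _]] := lewo A.
  by exists x; apply/asboolP; constructor.
have tx : le t x by apply: tA; apply/asboolP; constructor.
have ty : le t y by apply: tA; apply/asboolP; constructor.
have tz : le t z by apply: tA; apply/asboolP; constructor.
case: At => tE; move: tx ty tz; rewrite tE => tx ty tz //.
- have -> // : x = y by apply: (wo_anti lewo); rewrite xy tx.
- have zy : y = z by apply: (wo_anti lewo); rewrite yz ty.
  by rewrite -zy.
Qed.

Lemma wo_sub T (le : rel T) (S : set T) : wochoice.well_order le ->
  wochoice.well_order (fun u v : {x | S x} => le (sval u) (sval v)).
Proof.
move=> lewo; apply: wochoice.antisymmetric_well_order.
  move=> [x Sx] [y Sy] /= /(wo_anti lewo) xy.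
  by apply: eq_exist.
move=> A [[x Sx] Ax].
pose B : {pred T} := fun z => `[< exists Sz : S z, exist _ z Sz \in A >].
have [|z [[/asboolP[Sz Az] zB] _]] := lewo B.
  by exists x; apply/asboolP; exists Sx.
exists (exist _ z Sz); split=> // -[w Sw] Aw /=.
by apply: zB; apply/asboolP; exists Sw.
Qed.

Lemma wo_ind T (le : rel T) (Q : T -> Prop) : wochoice.well_order le ->
  (forall x, (forall y, le y x -> y <> x -> Q y) -> Q x) -> forall x, Q x.
Proof.
move=> lewo IH x; apply: contrapT => nQx.
have [|z [[/asboolP nQz zA] _]] := lewo (fun z => `[< ~ Q z >]).
  by exists x; apply/asboolP.
apply: nQz; apply: IH => y yz ney; apply: contrapT => nQy.
apply: ney; apply: (wo_anti lewo); rewrite yz; apply: zA; exact/asboolP.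
Qed.

Lemma total_bound T (le : rel T) n (g : 'I_n -> T) : inhabited T ->
  total le -> transitive le -> exists j, forall k, le (g k) j.
Proof.
move=> [t0] letot letr; elim: n => [|n IH] in g *; first by exists t0 => -[].
have [j jP] := IH (fun k => g (lift ord0 k)).
exists (if le (g ord0) j then j else g ord0) => k.
have [->|[k' ->]] : k = ord0 \/ exists k', k = lift ord0 k'.
    by case: (unliftP ord0 k) => [k' ->|->]; [right; exists k'|left].
  by case: ifP => // _; have /orP[] := letot (g ord0) (g ord0).
case: ifPn => // /negP njk; apply: letr (jP k') _.
by have /orP[] := letot (g ord0) j.
Qed.

(** * Least upper bounds of chains inside a fixed structure *)

Section Chains.
Variables (R : realType) (L : language) (K : MAEC R L) (V : Type).
Variable P : prestructure R L V.
Hypothesis Pstr : is_structure P.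
Local Notation cl := (closure_in (dom P) (dist P)).

Let Pm : metric_on (dom P) (dist P). Proof. by case: Pstr. Qed.
Let Pc : complete_on (dom P) (dist P). Proof. by case: Pstr. Qed.

(** The last clause is smoothness, read as leastness among the subsets of [P]. Here [P] is a
    structure that may lie outside the class, as the ultraproduct is not yet known to belong to
    it. *)
Definition prec_lub (J : Type) (A : set J) (Z : J -> set V) (C : set V) : Prop :=
  [/\ inK K (substr_on P C),
      forall j, A j -> prec K (substr_on P (Z j)) (substr_on P C) &
      forall W, W `<=` dom P ->
        (forall j, A j -> prec K (substr_on P (Z j)) (substr_on P W)) ->
        prec K (substr_on P C) (substr_on P W)].

Lemma substr_on_closed Z : Z `<=` dom P -> inK K (substr_on P Z) -> cl Z `<=` Z.
Proof.
move=> ZP /inK_structure[_ _ Zc _ _]; exact: complete_closed Zc.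
Qed.

(** The chain axiom yields some structure [N] on the closure of the union. Its symbols agree with
    those of [P] on the members of the chain, hence on the closure by continuity, so [N] is the
    restriction of [P]. *)
Lemma chain_lub (J : Type) (le : rel J) (Z : J -> set V) :
  (forall j, Z j `<=` dom P) ->
  is_chain (@prec _ _ K) le (fun j => substr_on P (Z j)) ->
  prec_lub setT Z (cl (\bigcup_j Z j)).
Proof.
move=> ZP ch; have [lewo J0 lechain] := ch.
set D := \bigcup_j Z j; have DP : D `<=` dom P by move=> x [j _ /ZP].
have CP := @closure_in_subl R V (dom P) (dist P) D.
have DC : D `<=` cl D by exact: subset_closure_in.
have [| | | | | N [[NK ZN NcD] domN distN _]] :=
  @chain_interp R L K V J le _ (cl D) (dist P) ch.
- exact: metric_onS Pm.
- exact: closed_complete (closure_in_closure Pm DP).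
- exact: DC.
- move=> x xD; split=> // e e0.
  by case: xD => _ /(_ _ e0).
- by [].
have Nstr := inK_structure NK; have [_ _ _ Nf Np] := Nstr.
have [_ _ _ Pf Pp] := Pstr.
(* A finite tuple is approximated within a single member of the chain, as the index order is
   total. *)
have approx n (x : 'I_n -> V) (e : R) : 0 < e -> tuple_in (cl D) x ->
    exists j, exists2 y, tuple_in (Z j) y & forall k, dist P (x k) (y k) < e.
  move=> e0 Cx.
  have /choice[y yP] : forall k, exists a, D a /\ dist P (x k) a < e.
    by move=> k; have [_ /(_ _ e0)[a]] := Cx k; exists a.
  have /choice[g gP] : forall k, exists j, Z j (y k).
    by move=> k; have [[j]] := yP k; exists j.
  have [j jP] := total_bound g J0 (wo_total lewo) (wo_trans lewo).
  exists j, y => k; last by have [] := yP k.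
  by have [/(_ _ (gP k))] := prec_sub (lechain _ _ (jP k)).
have Cf f (x : 'I_(farity f) -> V) : tuple_in (cl D) x ->
    cl D (finterp N x) /\ finterp N x = finterp P x.
  move=> Cx; have NCx : tuple_in (dom N) x by rewrite domN.
  have [Nfx Nfc] := Nf f x NCx; rewrite domN in Nfx; split=> //.
  have PCx : tuple_in (dom P) x by move=> k; exact: CP.
  have [Pfx Pfc] := Pf f x PCx.
  apply: (metric_on_eq Pm) => //; first exact: CP.
  move=> e e0; have e20 : 0 < e / 2 by lra.
  have [r r0 rP] := Nfc _ e20; have [s s0 sP] := Pfc _ e20.
  have [|j [y Zy xy]] := approx _ x (Num.min r s) _ Cx; first by rewrite lt_min r0.
  have Dy k : D (y k) by exists j.
  have fyE : finterp N y = finterp P y by have [_ _ <-] := ZN j.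
  have Ny : tuple_in (dom N) y by move=> k; rewrite domN; exact: DC.
  have Py : tuple_in (dom P) y by move=> k; exact: DP.
  have Cfy : cl D (finterp N y) by rewrite -domN; have [] := Nf f y Ny.
  have d1 := rP _ Ny; have d2 := sP _ Py.
  have {}d1 : dist N (finterp N x) (finterp N y) < e / 2.
    apply: d1 => k; rewrite distN//; last exact: DC.
    by apply: lt_le_trans (xy k) _; rewrite ge_min lexx.
  have {}d2 : dist P (finterp P x) (finterp P y) < e / 2.
    by apply: d2 => k; apply: lt_le_trans (xy k) _; rewrite ge_min lexx orbT.
  rewrite distN// in d1.
  have := metric_on_triangle Pm (CP _ Nfx) (CP _ Cfy) Pfx.
  by rewrite -fyE in d2; rewrite (metric_onC Pm (CP _ Cfy) Pfx); lra.
have Cp p (x : 'I_(parity p) -> V) : tuple_in (cl D) x ->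
    pinterp N x = pinterp P x.
  move=> Cx; have NCx : tuple_in (dom N) x by rewrite domN.
  have PCx : tuple_in (dom P) x by move=> k; exact: CP.
  apply/eqP; rewrite -subr_eq0 -normr_le0; apply/ler_addgt0Pr => e e0.
  have e20 : 0 < e / 2 by lra.
  have [r r0 rP] := Np p x NCx _ e20; have [s s0 sP] := Pp p x PCx _ e20.
  have [|j [y Zy xy]] := approx _ x (Num.min r s) _ Cx; first by rewrite lt_min r0.
  have Dy k : D (y k) by exists j.
  have pyE : pinterp N y = pinterp P y by have [_ _ _ <-] := ZN j.
  have Ny : tuple_in (dom N) y by move=> k; rewrite domN; exact: DC.
  have Py : tuple_in (dom P) y by move=> k; exact: DP.
  have d1 := rP _ Ny; have d2 := sP _ Py.
  have {}d1 : `|pinterp N x - pinterp N y| < e / 2.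
    apply: d1 => k; rewrite distN//; last exact: DC.
    by apply: lt_le_trans (xy k) _; rewrite ge_min lexx.
  have {}d2 : `|pinterp P x - pinterp P y| < e / 2.
    by apply: d2 => k; apply: lt_le_trans (xy k) _; rewrite ge_min lexx orbT.
  rewrite add0r; apply/ltW; rewrite pyE in d1; rewrite distrC in d2.
  have := ler_distD (pinterp P y) (pinterp N x) (pinterp P x); lra.
(* [N] and the restriction of [P] may differ outside their universe, so the identity serves as an
   isomorphism in place of an equality. *)
have CK : inK K (substr_on P (cl D)).
  apply: (inK_iso (h := idfun)) NK; split=> /=.
  - by rewrite domN; split=> // x Cx; exists x.
  - by rewrite domN => x y Cx Cy; rewrite distN.
  - by rewrite domN => f x /Cf[_ ->].
  - by rewrite domN => p x /Cp ->.
have Ccomp : is_completion (@inK _ _ K) (fun j => substr_on P (Z j)) (substr_on P (cl D)).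
  split=> //= [j|].
    by apply: substr_on_sub => x Zx; apply: DC; exists j.
  by move=> x xD; split=> // e e0; have [_ /(_ _ e0)] := xD.
split=> // [j _|W WP ZW]; first exact: (chain_prec ch Ccomp).
apply: (chain_smooth ch Ccomp) => [|j]; last exact: ZW.
(* Any index [j0] shows that [W] is in the class, hence complete and closed in [P]; so it contains
   the closure of the union. *)
apply: substr_on_sub; have [j0] := J0.
apply: subset_trans (substr_on_closed WP _); last by have [] := prec_inK (ZW j0 Logic.I).
apply: closure_inS => x [j _ Zx].
by have [/(_ _ Zx)] := prec_sub (ZW j Logic.I).
Qed.

End Chains.

(** * Closure of the class under directed unions *)

(** [F a] is built by recursion on the cardinality of [a], as an upper bound of the elements of [a]
    and of earlier values at the subsets of [a]. *)
Lemma directed_fset_map (J : choiceType) (leJ : J -> J -> Prop) :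
  inhabited J -> (forall j, leJ j j) ->
  (forall i j k, leJ i j -> leJ j k -> leJ i k) ->
  (forall i j, exists2 k, leJ i k & leJ j k) ->
  exists2 F : {fset J} -> J,
    forall a b, (a `<=` b)%fset -> leJ (F a) (F b) & forall j, leJ j (F [fset j]%fset).
Proof.
move=> [j0] lexx letr ledir.
have /choice[ub ubP] : forall s : seq J, exists c, forall x, x \in s -> leJ x c.
  elim=> [|x s [c cP]]; first by exists j0.
  have [k xk ck] := ledir x c; exists k => y; rewrite inE => /orP[/eqP->//|/cP yc].
  exact: letr ck.
(* The level [n] will be the cardinality of [a]. Level [m.+1] bounds level [m] at all subsets of
   [a], including [a] itself, so levels may also be skipped. *)
pose hull := fix hull n (a : {fset J}) := match n with
  | 0%N => ub (enum_fset a)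
  | m.+1 => ub (enum_fset a ++ [seq hull m b | b <- enum_fset (fpowerset a)]) end.
have hullS n (a b : {fset J}) : (b `<=` a)%fset -> leJ (hull n b) (hull n.+1 a).
  move=> ba; apply: ubP; rewrite mem_cat; apply/orP; right.
  by apply/mapP; exists b => //; rewrite -[_ \in _]/(b \in fpowerset a) fpowersetE.
have hull_lt n m (a b : {fset J}) :
    (n < m)%N -> (b `<=` a)%fset -> leJ (hull n b) (hull m a).
  elim: m a => // m IH a; rewrite ltnS leq_eqVlt => /orP[/eqP->|nm] ba.
    exact: hullS.
  by apply: letr (IH a nm ba) _; exact: hullS.
exists (fun a => hull #|`a|%fset a) => [a b ab|j].
  have [->//|neab] := eqVneq a b.
  by apply: hull_lt => //; apply: fproper_ltn_card; rewrite fproperEneq neab.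
rewrite cardfs1; apply: ubP.
by rewrite mem_cat -[X in X || _]/(j \in [fset j]%fset) inE eqxx.
Qed.

Section DirectedUnions.
Variables (R : realType) (L : language) (K : MAEC R L) (V : Type).
Variable P : prestructure R L V.
Hypothesis Pstr : is_structure P.
Local Notation cl := (closure_in (dom P) (dist P)).
Variables (J : Type) (leJ : J -> J -> Prop) (X : J -> set V).
Hypothesis XP : forall j, X j `<=` dom P.
Hypothesis X_prec : forall i j, leJ i j ->
  prec K (substr_on P (X i)) (substr_on P (X j)).
Hypothesis lexx : forall j, leJ j j.

Let Pm : metric_on (dom P) (dist P). Proof. by case: Pstr. Qed.

Let X_sub i j : leJ i j -> X i `<=` X j.
Proof. by move=> /X_prec/prec_sub[]. Qed.

Section WellOrdered.
Variables (T : choiceType) (le : rel T).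
Hypothesis lewo : wochoice.well_order le.

Definition fsubs (S : set T) : set {fset T} := [set a | [set` a] `<=` S].

Definition segment (y : T) : set T := [set x | le x y /\ x <> y].

Definition fhull (F : {fset T} -> J) (S : set T) : set V :=
  cl (\bigcup_(a in fsubs S) X (F a)).

(* Quantifying over [F] lets the induction on initial segments [S] pass
   successor stages. *)
Definition fhull_lub (S : set T) : Prop :=
  forall F : {fset T} -> J,
    (forall a b, (a `<=` b)%fset -> leJ (F a) (F b)) ->
    prec_lub K P (fsubs S) (X \o F) (fhull F S).

(** Only [fset0] contributes, and [X (F fset0)] is already closed, being complete. *)
Lemma fhull_lub0 : fhull_lub set0.
Proof.
move=> F _; have s0 : fsubs set0 fset0 by move=> x.
have s0E a : fsubs set0 a -> a = fset0.
  by move=> a0; apply/fsetP => x; rewrite !inE; apply/negP => /a0.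
have XF : inK K (substr_on P (X (F fset0))) by have [] := prec_inK (X_prec (lexx (F fset0))).
have XFE : fhull F set0 = X (F fset0).
  apply/seteqP; split.
    apply: subset_trans (substr_on_closed Pstr (@XP _) XF).
    by apply: closure_inS => x [a /s0E->].
  apply: subset_trans (closure_inS (_ : X (F fset0) `<=` _)); last first.
    by move=> x; exists fset0.
  exact: subset_closure_in.
rewrite /prec_lub XFE; split=> // [a /s0E -> /=|W _]; last by apply.
exact: X_prec.
Qed.

(** The sets containing [y] are cofinal among the finite subsets of [S], so reindexing by [F']
    changes neither the closure of the union nor the upper bounds. *)
Lemma fhull_lub_max (S : set T) y : S y -> (forall x, S x -> le x y) ->
  (forall x z, S z -> le x z -> S x) ->
  fhull_lub (segment y) -> fhull_lub S.
Proof.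
move=> Sy ymax Sdown IH F Fmono.
pose F' a := F (y |` a)%fset.
have F'mono a b : (a `<=` b)%fset -> leJ (F' a) (F' b).
  by move=> ab; apply: Fmono; exact: fsetUS.
have s1 a : fsubs (segment y) a -> fsubs S (y |` a)%fset.
  by move=> ay x /=; rewrite !inE => /orP[/eqP->//|/ay[+ _]]; exact: Sdown.
have s2 a : fsubs S a -> fsubs (segment y) (a `\ y)%fset.
  move=> aS x /=; rewrite !inE => /andP[/eqP xy /aS Sx].
  by split=> //; exact: ymax.
have FF' a : leJ (F a) (F' (a `\ y)%fset).
  apply: Fmono; apply/fsubsetP => x xa; rewrite !inE xa andbT.
  by case: eqVneq.
have E : fhull F S = fhull F' (segment y).
  congr cl; apply/seteqP; split=> x [a aS Xa].
    by exists (a `\ y)%fset; [exact: s2|exact: X_sub Xa].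
  by exists (y |` a)%fset => //; exact: s1.
rewrite /prec_lub E; have [i1 i2 i3] := IH F' F'mono; split=> //= [a aS|W WP SW].
  exact: prec_trans (X_prec (FF' a)) (i2 _ (s2 _ aS)).
by apply: i3 => // a /s1; exact: SW.
Qed.

(** Without a maximum, each finite subset of [S] lies in [segment y] for some [y] in [S]. So the
    stage of [S] is the closure of the union of the earlier stages, which form a chain. *)
Lemma fhull_lub_lim (S : set T) : S !=set0 ->
  (forall y, S y -> exists2 x, S x & ~ le x y) ->
  (forall x z, S z -> le x z -> S x) ->
  (forall y, S y -> fhull_lub (segment y)) -> fhull_lub S.
Proof.
move=> [y0 Sy0] nmax Sdown IH F Fmono.
have letot := wo_total lewo; have letr := wo_trans lewo.
have leanti := wo_anti lewo.
have segS u v x : le u v -> segment u x -> segment v x.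
  move=> uv [xu nxu]; split; first exact: letr uv.
  by move=> xv; apply: nxu; apply: leanti; rewrite xu xv.
have bound (s : seq T) : (forall x, x \in s -> S x) ->
    exists2 y, S y & forall x, x \in s -> segment y x.
  elim: s => [|x s IHs] sS; first by exists y0.
  have [|y Sy yP] := IHs; first by move=> z zs; apply: sS; rewrite inE zs orbT.
  have [z Sz nzx] := nmax x (sS _ (mem_head _ _)).
  have xz : segment z x.
    split; first by have /orP[] := letot x z.
    by move=> xz; apply: nzx; rewrite xz; have /orP[] := letot z z.
  have /orP[yz|zy] := letot y z.
    by exists z => // w; rewrite inE => /orP[/eqP->//|/yP]; exact: segS.
  by exists y => // w; rewrite inE => /orP[/eqP->|/yP//]; exact: segS xz.
have sub_seg a : fsubs S a -> exists2 y, S y & fsubs (segment y) a.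
  by move=> aS; have [y Sy yP] := bound (enum_fset a) aS; exists y.
have seg_sub y a : S y -> fsubs (segment y) a -> fsubs S a.
  by move=> Sy ay x /ay[+ _]; exact: Sdown.
pose le' := (fun u v : {x | S x} => le (sval u) (sval v)).
pose Z := fun u : {x | S x} => fhull F (segment (sval u)).
have ZP u : Z u `<=` dom P by exact: closure_in_subl.
have ch : is_chain (@prec _ _ K) le' (fun u => substr_on P (Z u)).
  split; [exact: wo_sub|by constructor; exists y0|].
  (* The stage of [v] is an upper bound of the family defining the stage of [u], so leastness of the
     latter gives the relation. *)
  move=> [u Su] [v Sv] uv; have [_ _ u3] := IH u Su F Fmono.
  have [_ v2 _] := IH v Sv F Fmono.
  apply: u3 => // a au; apply: v2 => x /au; exact: segS.
have DP : \bigcup_(a in fsubs S) X (F a) `<=` dom P by move=> x [a _ /XP].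
have E : fhull F S = cl (\bigcup_u Z u).
  apply/seteqP; split.
    apply: closure_inS => x [a /sub_seg[y Sy ya] Xx].
    exists (exist _ y Sy) => //; apply: subset_closure_in => //=; last by exists a.
    by move=> z [b _ /XP].
  apply: subset_trans (closure_in_closure Pm DP).
  apply: closure_inS => x [[y Sy] _]; apply: closure_inS => z [a ay Xz].
  by exists a => //; exact: seg_sub ay.
have [c1 c2 c3] := chain_lub Pstr ZP ch.
rewrite /prec_lub E; split=> // [a /sub_seg[y Sy ya]|W WP SW].
  have [_ y2 _] := IH y Sy F Fmono.
  exact: prec_trans (y2 _ ya) (c2 (exist _ y Sy) Logic.I).
apply: c3 => // -[y Sy] _; have [_ _ y3] := IH y Sy F Fmono.
by apply: y3 => // a /(seg_sub _ _ Sy); exact: SW.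
Qed.

Lemma fhull_lub_initial (S : set T) :
  (forall x z, S z -> le x z -> S x) ->
  (forall y, S y -> fhull_lub (segment y)) -> fhull_lub S.
Proof.
move=> Sdown IH; have [->|/set0P S0] := eqVneq S set0; first exact: fhull_lub0.
have [[y [Sy ymax]]|nmax] := pselect (exists y, S y /\ forall x, S x -> le x y).
  exact: fhull_lub_max (IH y Sy).
apply: fhull_lub_lim => // y Sy; apply: contrapT => ny.
apply: nmax; exists y; split=> // x Sx; apply: contrapT => nxy.
by apply: ny; exists x.
Qed.

Lemma fhull_lubT : fhull_lub setT.
Proof.
(* The induction covers the proper segments; the whole set is one further instance of the same
   step. *)
apply: fhull_lub_initial => // y _; move: y; apply: (wo_ind lewo) => y IH.
apply: fhull_lub_initial => [x z [zy nzy] xz|z [zy nzy]]; last exact: IH.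
split; first exact: (wo_trans lewo) zy.
by move=> xy; apply: nzy; apply: (wo_anti lewo); rewrite zy -xy xz.
Qed.

End WellOrdered.

(** [J] itself, well-ordered, serves as [T]. Singletons make the values of [F] cofinal in [J], and
    completeness makes the union equal to its closure. *)
Lemma directed_lub :
  inhabited J ->
  (forall i j k, leJ i j -> leJ j k -> leJ i k) ->
  (forall i j, exists2 k, leJ i k & leJ j k) ->
  complete_on (\bigcup_j X j) (dist P) ->
  prec_lub K P setT X (\bigcup_j X j).
Proof.
move=> J0 letr ledir Xc.
have DP : \bigcup_j X j `<=` dom P by move=> x [j _ /XP].
have [F Fmono jF] := @directed_fset_map {classic J} leJ J0 lexx letr ledir.
have [le lewo] := wochoice.well_ordering_principle {classic J}.
have E : fhull F setT = \bigcup_j X j.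
  apply/seteqP; split.
    apply: subset_trans (complete_closed Pm DP Xc).
    by apply: closure_inS => x [a _ Xx]; exists (F a).
  move=> x [j _ Xx]; apply: subset_closure_in => // [y [a _ /XP]//|].
  by exists [fset (j : {classic J})]%fset => //; exact: X_sub (jF j) _ Xx.
have [f1 f2 f3] := fhull_lubT lewo Fmono; rewrite E in f1 f2 f3.
split=> // [j _|W WP XW]; last by apply: f3 => // a _; exact: XW.
exact: prec_trans (X_prec (jF j)) (f2 [fset (j : {classic J})]%fset (@subsetT _ _)).
Qed.

End DirectedUnions.

(** * Structures with matching enumerated dense subsets *)

Section DenseEnumerations.
Variables (R : realType) (L : language) (T : Type).

Definition dense_enum (V : Type) (A : prestructure R L V) (e : T -> V) : Prop :=
  (forall t, dom A (e t)) /\ dom A `<=` closure_in (dom A) (dist A) (range e).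

(** Values of function symbols may leave the enumerated set; they are recorded by their distances to
    the enumerated points, which determine them by density. *)
Definition same_enum (V W : Type) (A : prestructure R L V) (B : prestructure R L W)
    (e : T -> V) (g : T -> W) : Prop :=
  [/\ forall s t, dist A (e s) (e t) = dist B (g s) (g t),
      forall f (s : 'I_(farity f) -> T) t,
        dist A (finterp A (e \o s)) (e t) = dist B (finterp B (g \o s)) (g t) &
      forall p (s : 'I_(parity p) -> T),
        pinterp A (e \o s) = pinterp B (g \o s)].

(** The graph of the isomorphism to be constructed. *)
Definition enum_rel (V W : Type) (A : prestructure R L V) (B : prestructure R L W)
    (e : T -> V) (g : T -> W) (x : V) (y : W) : Prop :=
  [/\ dom A x, dom B y & forall t, dist A x (e t) = dist B y (g t)].

Lemma same_enumC V W (A : prestructure R L V) (B : prestructure R L W) e g :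
  same_enum A B e g -> same_enum B A g e.
Proof. by move=> [h1 h2 h3]; split=> *; rewrite ?h1 ?h2 ?h3. Qed.

Lemma enum_relC V W (A : prestructure R L V) (B : prestructure R L W) e g x y :
  enum_rel A B e g x y -> enum_rel B A g e y x.
Proof. by move=> [h1 h2 h3]; split. Qed.

Lemma enum_near V (A : prestructure R L V) e x (r : R) : dense_enum A e ->
  dom A x -> 0 < r -> exists t, dist A x (e t) < r.
Proof. by move=> [_ eA] /eA[_ xe] /xe[_ [t _ <-]]; exists t. Qed.

(** Take labels whose points in [A] tend to [x]; the points of [B] with the same labels form a
    Cauchy sequence, and [y] is its limit. *)
Lemma enum_rel_ex V W (A : prestructure R L V) (B : prestructure R L W) e g x :
  is_structure A -> is_structure B -> dense_enum A e -> dense_enum B g ->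
  same_enum A B e g -> dom A x -> exists y, enum_rel A B e g x y.
Proof.
move=> [_ Am _ _ _] [_ Bm Bc _ _] [eA ed] [gB gd] [dE _ _] Ax.
have /choice[u xu] : forall n : nat, exists t, dist A x (e t) < n.+1%:R^-1.
  move=> n; apply: enum_near => //; by rewrite invr_gt0.
have [|r r0|y By uy] := Bc (g \o u); first by move=> n; exact: gB.
  have r20 : 0 < r / 2 by lra.
  have [N Ne] := invSn_lt r20; exists N => m n Nm Nn /=; rewrite -dE.
  have := metric_on_triangle Am (eA (u m)) Ax (eA (u n)).
  rewrite (metric_onC Am (eA (u m)) Ax).
  have := lt_trans (xu m) (Ne _ Nm); have := lt_trans (xu n) (Ne _ Nn); lra.
exists y; split=> // t.
have near_uy r : 0 < r -> exists n, dist A x (e (u n)) < r /\ dist B y (g (u n)) < r.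
  move=> r0; have [N Ne] := invSn_lt r0; have [N' N'e] := uy _ r0.
  exists (maxn N N'); split; first exact: lt_trans (xu _) (Ne _ (leq_maxl _ _)).
  by rewrite (metric_onC Bm)//; exact: N'e (leq_maxr _ _).
apply/eqP; rewrite eq_le; apply/andP; split; apply/ler_addgt0Pr => r r0.
all: have r20 : 0 < r / 2 by lra.
all: have [n [xn yn]] := near_uy _ r20.
  have := metric_on_triangle Am Ax (eA (u n)) (eA t); rewrite dE.
  have := metric_on_triangle Bm (gB (u n)) By (gB t); rewrite (metric_onC Bm (gB (u n)) By).
  lra.
have := metric_on_triangle Bm By (gB (u n)) (gB t); rewrite -dE.
have := metric_on_triangle Am (eA (u n)) Ax (eA t); rewrite (metric_onC Am (eA (u n)) Ax).
lra.
Qed.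

(** An enumerated point near [x'] has its counterpart equally near [y']. The reverse inequality
    follows by exchanging the structures. *)
Lemma enum_rel_dist_le V W (A : prestructure R L V) (B : prestructure R L W) e g
    x y x' y' :
  is_structure A -> is_structure B -> dense_enum A e -> dense_enum B g ->
  enum_rel A B e g x y -> enum_rel A B e g x' y' -> dist A x x' <= dist B y y'.
Proof.
move=> [_ Am _ _ _] [_ Bm _ _ _] ed [gB _] [Ax By xy] [Ax' By' xy'].
apply/ler_addgt0Pr => r r0; have r20 : 0 < r / 2 by lra.
have [t xt] := enum_near ed Ax' r20.
have At := ed.1 t; have yt := xt; rewrite xy' in yt.
have := metric_on_triangle Am Ax At Ax'; rewrite (metric_onC Am At Ax') xy.
have := metric_on_triangle Bm By By' (gB t); lra.
Qed.

Lemma enum_rel_dist V W (A : prestructure R L V) (B : prestructure R L W) e g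
    x y x' y' :
  is_structure A -> is_structure B -> dense_enum A e -> dense_enum B g ->
  enum_rel A B e g x y -> enum_rel A B e g x' y' -> dist A x x' = dist B y y'.
Proof.
move=> As Bs ed gd xy xy'; apply/eqP; rewrite eq_le.
rewrite (enum_rel_dist_le As Bs ed gd xy xy').
exact: (enum_rel_dist_le Bs As gd ed (enum_relC xy) (enum_relC xy')).
Qed.

Lemma enum_rel_approx V W (A : prestructure R L V) (B : prestructure R L W) e g
    n (x : 'I_n -> V) (y : 'I_n -> W) (r : R) : dense_enum A e ->
  (forall k, enum_rel A B e g (x k) (y k)) -> 0 < r ->
  exists s : 'I_n -> T, forall k, dist A (x k) (e (s k)) < r /\
                                 dist B (y k) (g (s k)) < r.
Proof.
move=> ed xy r0.
suff /choice[s sP] : forall k, exists t,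
    dist A (x k) (e t) < r /\ dist B (y k) (g t) < r by exists s.
move=> k; have [Ax By xyE] := xy k; have [t xt] := enum_near ed Ax r0.
by exists t; rewrite -xyE.
Qed.

(** One tuple of labels approximates [x] and [y] at once; continuity in both structures reduces the
    claim to enumerated tuples, where [same_enum] applies. *)
Lemma enum_rel_finterp_le V W (A : prestructure R L V) (B : prestructure R L W) e g
    f (x : 'I_(farity f) -> V) (y : 'I_(farity f) -> W) t :
  is_structure A -> is_structure B -> dense_enum A e -> dense_enum B g ->
  same_enum A B e g -> (forall k, enum_rel A B e g (x k) (y k)) ->
  dist A (finterp A x) (e t) <= dist B (finterp B y) (g t).
Proof.
move=> [_ Am _ Af _] [_ Bm _ Bf _] ed gd [_ fE _] xy.
have Ax : tuple_in (dom A) x by move=> k; have [] := xy k.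
have By : tuple_in (dom B) y by move=> k; have [] := xy k.
have [Afx Afc] := Af _ _ Ax; have [Bfy Bfc] := Bf _ _ By.
apply/ler_addgt0Pr => r r0; have r20 : 0 < r / 2 by lra.
have [a a0 aP] := Afc _ r20; have [b b0 bP] := Bfc _ r20.
have ab0 : 0 < Num.min a b by rewrite lt_min a0.
have [s sP] := enum_rel_approx ed xy ab0.
have As : tuple_in (dom A) (e \o s) by move=> k; exact: ed.1.
have Bs : tuple_in (dom B) (g \o s) by move=> k; exact: gd.1.
have d1 : dist A (finterp A x) (finterp A (e \o s)) < r / 2.
  apply: aP => // k; have [h _] := sP k.
  by apply: lt_le_trans h _; rewrite ge_min lexx.
have d2 : dist B (finterp B y) (finterp B (g \o s)) < r / 2.
  apply: bP => // k; have [_ h] := sP k.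
  by apply: lt_le_trans h _; rewrite ge_min lexx orbT.
have Afs := (Af _ _ As).1; have Bfs := (Bf _ _ Bs).1.
have := metric_on_triangle Am Afx Afs (ed.1 t); rewrite fE.
have := metric_on_triangle Bm Bfs Bfy (gd.1 t); rewrite (metric_onC Bm Bfs Bfy); lra.
Qed.

Lemma enum_rel_finterp V W (A : prestructure R L V) (B : prestructure R L W) e g
    f (x : 'I_(farity f) -> V) (y : 'I_(farity f) -> W) :
  is_structure A -> is_structure B -> dense_enum A e -> dense_enum B g ->
  same_enum A B e g -> (forall k, enum_rel A B e g (x k) (y k)) ->
  enum_rel A B e g (finterp A x) (finterp B y).
Proof.
move=> As Bs ed gd eg xy; split=> [||t].
- have [_ _ _ Af _] := As; apply: (Af _ _ _).1 => k; by have [] := xy k.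
- have [_ _ _ Bf _] := Bs; apply: (Bf _ _ _).1 => k; by have [] := xy k.
- apply/eqP; rewrite eq_le (enum_rel_finterp_le _ As Bs ed gd eg xy).
  apply: (enum_rel_finterp_le _ Bs As gd ed (same_enumC eg)) => k.
  exact: enum_relC.
Qed.

Lemma enum_rel_pinterp V W (A : prestructure R L V) (B : prestructure R L W) e g
    p (x : 'I_(parity p) -> V) (y : 'I_(parity p) -> W) :
  is_structure A -> is_structure B -> dense_enum A e -> dense_enum B g ->
  same_enum A B e g -> (forall k, enum_rel A B e g (x k) (y k)) ->
  pinterp A x = pinterp B y.
Proof.
move=> [_ Am _ _ Ap] [_ Bm _ _ Bp] ed gd [_ _ pE] xy.
have Ax : tuple_in (dom A) x by move=> k; have [] := xy k.
have By : tuple_in (dom B) y by move=> k; have [] := xy k.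
apply/eqP; rewrite -subr_eq0 -normr_le0; apply/ler_addgt0Pr => r r0.
have r20 : 0 < r / 2 by lra.
have [a a0 aP] := Ap _ _ Ax _ r20; have [b b0 bP] := Bp _ _ By _ r20.
have ab0 : 0 < Num.min a b by rewrite lt_min a0.
have [s sP] := enum_rel_approx ed xy ab0.
have d1 : `|pinterp A x - pinterp A (e \o s)| < r / 2.
  apply: aP => k; first exact: ed.1.
  by have [h _] := sP k; apply: lt_le_trans h _; rewrite ge_min lexx.
have d2 : `|pinterp B y - pinterp B (g \o s)| < r / 2.
  apply: bP => k; first exact: gd.1.
  by have [_ h] := sP k; apply: lt_le_trans h _; rewrite ge_min lexx orbT.
rewrite distrC -pE in d2; rewrite add0r.
have := ler_distD (pinterp A (e \o s)) (pinterp A x) (pinterp B y); lra.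
Qed.

(* The isomorphism sends [x] to the only [y] at the same distances from the
   enumerated points, so it also respects closures of enumerated subsets. *)
Lemma same_enum_isomorphism V W (A : prestructure R L V) (B : prestructure R L W)
    e g :
  is_structure A -> is_structure B -> dense_enum A e -> dense_enum B g ->
  same_enum A B e g ->
  exists2 h, isomorphism A B h & forall Q : set T,
    set_bij (closure_in (dom A) (dist A) (e @` Q))
            (closure_in (dom B) (dist B) (g @` Q)) h.
Proof.
move=> As Bs ed gd eg; have ge := same_enumC eg.
have [_ Am _ Af _] := As; have [[w0 _] Bm _ _ _] := Bs.
(* [w0] is the default value outside [dom A]. *)
have /choice[h hP] : forall x, exists y, dom A x -> enum_rel A B e g x y.
  move=> x; have [Ax|nAx] := pselect (dom A x); last by exists w0.
  by have [y xy] := enum_rel_ex As Bs ed gd eg Ax; exists y.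
have hdist x y : dom A x -> dom A y -> dist B (h x) (h y) = dist A x y.
  by move=> /hP hx /hP hy; rewrite (enum_rel_dist As Bs ed gd hx hy).
have hinj : {in dom A &, injective h}.
  move=> x y /set_mem Ax /set_mem Ay hxy; have [d0 _ _] := Am.
  have [_ Bhy _] := hP _ Ay.
  by apply/d0 => //; rewrite -hdist// hxy; exact: (metric_onxx Bm Bhy).
have huniq x y : enum_rel A B e g x y -> h x = y.
  move=> xy; have [Ax By _] := xy; have hx := hP _ Ax; have [_ Bhx _] := hx.
  have [d0 _ _] := Bm; apply/d0 => //.
  by rewrite -(enum_rel_dist As Bs ed gd hx xy); exact: (metric_onxx Am Ax).
have hsurj y : dom B y -> exists2 x, dom A x & enum_rel A B e g x y.
  move=> By; have [x yx] := enum_rel_ex Bs As gd ed ge By.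
  by exists x; [case: yx|exact: enum_relC].
exists h.
  split=> //.
  - split=> //; first by move=> x /hP[].
    by move=> y /hsurj[x Ax xy]; exists x => //; exact: huniq.
  - move=> f x Ax; apply: huniq; apply: enum_rel_finterp => // k; exact: hP.
  - move=> p x Ax; apply/esym; apply: (enum_rel_pinterp As Bs ed gd eg) => k; exact: hP.
move=> Q; split.
- move=> x [Ax xQ]; have [_ Bhx hx] := hP _ Ax; split=> // r /xQ[_ [t Qt <-] xt].
  by exists (g t); [exists t|rewrite -hx].
- by move=> x y /set_mem[Ax _] /set_mem[Ay _]; apply: hinj; exact: mem_set.
- move=> y [By yQ]; have [x Ax xy] := hsurj _ By; exists x; last exact: huniq.
  split=> // r /yQ[_ [t Qt <-] yt]; exists (e t); first by exists t.
  by have [_ _ ->] := xy.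
Qed.

End DenseEnumerations.

(** * Dependent choice and small index types *)

Lemma dep_choice (I : Type) (V : I -> Type) (Q : forall i, V i -> Prop) :
  (forall i, exists x, Q i x) -> exists f : forall i, V i, forall i, Q i (f i).
Proof.
by move=> H; exists (fun i => projT1 (cid (H i))) => i; case: cid.
Qed.

Section SmallIndices.
Variables (I : Type) (U : set_system I) (UU : UltraFilter U).

(* Closure of [U] under [T]-indexed intersections passes to sums, products and
   tuples, which replaces the cardinal arithmetic of the infinite cardinal LS. *)
Definition usmall (T : Type) : Prop :=
  forall A : T -> set I, (forall t, U (A t)) -> U [set i | forall t, A t i].

Lemma usmall_prod S T : usmall S -> usmall T -> usmall (S * T).
Proof.
move=> Ss Ts A UA.
have : U [set i | forall s t, A (s, t) i].
  by apply: (Ss (fun s => [set i | forall t, A (s, t) i])) => s; exact: Ts.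
by apply: filterS => i Ai [s t]; exact: Ai.
Qed.

Lemma usmall_sum S T : usmall S -> usmall T -> usmall (S + T).
Proof.
move=> Ss Ts A UA.
have : U ([set i | forall s, A (inl s) i] `&` [set i | forall t, A (inr t) i]).
  apply: filterI; first by apply: (Ss (A \o inl)) => s; exact: UA.
  by apply: (Ts (A \o inr)) => t; exact: UA.
by apply: filterS => i [Al Ar] [s|t]; [exact: Al|exact: Ar].
Qed.

Lemma usmall_tuple n T : usmall T -> usmall ('I_n -> T).
Proof.
move=> Ts; elim: n => [|n IH] A UA.
  have f0 : 'I_0 -> T by case.
  apply: filterS (UA f0) => i Ai f; suff -> : f = f0 by [].
  by apply/funext => -[].
pose cons t (f : 'I_n -> T) : 'I_n.+1 -> T := fun k => oapp f t (unlift ord0 k).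
have : U [set i | forall t f, A (cons t f) i].
  by apply: (Ts (fun t => [set i | forall f, A (cons t f) i])) => t; exact: IH.
apply: filterS => i Ai f; rewrite (_ : f = cons (f ord0) (f \o lift ord0))//.
by apply/funext => k; rewrite /cons; case: unliftP => [j ->|->].
Qed.

(** Otherwise the complements of all fibres of [c] lie in [U], and so does their intersection, which
    is empty. *)
Lemma usmall_pigeonhole T (c : I -> T) : usmall T -> exists t, U [set i | c i = t].
Proof.
move=> Ts; apply: contrapT => nU.
have /Ts/filter_ex[i /(_ (c i))] // : forall t, U [set i | c i <> t].
move=> t; have [Ut|//] := in_ultra_setVsetC [set i | c i = t] UU.
by case: nU; exists t.
Qed.

Variable kappa : Type.
Hypothesis Uc : succ_complete kappa U.

Lemma usmall_card_le T : ([set: T] #<= [set: kappa])%card -> usmall T.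
Proof.
move=> Tk A UA; have : U (\bigcap_(B in range A) B).
  apply: Uc => [|_ [t _ <-]//]; exact: card_le_trans (card_image_le _ _) Tk.
by apply: filterS => i Ai t; apply: Ai; exists t.
Qed.

Lemma usmall_nat : infinite_set [set: kappa] -> usmall nat.
Proof. by move=> /infiniteP; exact: usmall_card_le. Qed.

End SmallIndices.

(** * The ultraproduct as a structure, and its substructures *)

Section UltraproductStructure.
Variables (R : realType) (L : language) (I : Type) (U : set_system I).
Variables (UU : UltraFilter U) (kappa : Type) (Uc : succ_complete kappa U).
Hypothesis kinf : infinite_set [set: kappa].
Variables (V : I -> Type) (N : forall i, prestructure R L (V i)).
Hypothesis Nstr : forall i, is_structure (N i).
Local Notation "[ 'u' x ]" := (uclass U N x) (at level 0, x at level 99).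
Local Notation N' := (uprod U N).

Let Nm i : metric_on (dom (N i)) (dist (N i)). Proof. by have [] := Nstr i. Qed.

Let Unat : usmall U nat := usmall_nat UU Uc kinf.

(** Limits along a countably complete ultrafilter are values taken almost everywhere, so relations
    between distances in the ultraproduct can be checked at a single index. *)
Lemma uprod_dist_ae x y : seq_in N x -> seq_in N y ->
  U [set i | dist (N i) (x i) (y i) = dist N' [u x] [u y]].
Proof.
move=> Nx Ny.
have [r xyr] := ultra_cvg_ex UU Uc kinf (fun i => dist (N i) (x i) (y i)).
rewrite (uprod_distE UU Uc kinf Nstr Nx Ny xyr).
exact/(ultra_cvg_eq UU Uc kinf).
Qed.

Lemma uprod_pinterp_ae p (x : 'I_(parity p) -> forall i, V i) :
  (forall k, seq_in N (x k)) ->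
  U [set i | pinterp (N i) (fun k => x k i) = pinterp N' (fun k => [u x k])].
Proof.
move=> Nx.
have [r xr] := ultra_cvg_ex UU Uc kinf (fun i => pinterp (N i) (fun k => x k i)).
rewrite (uprod_pinterpE UU Uc kinf Nstr Nx xr).
exact/(ultra_cvg_eq UU Uc kinf).
Qed.

Lemma uclass_eqP x y : seq_in N x -> seq_in N y ->
  [u x] = [u y] <-> U [set i | x i = y i].
Proof.
move=> Nx Ny; rewrite (eq_uclass UU Uc kinf Nstr Nx Ny).
rewrite (ultra_cvg_eq UU Uc kinf); split; apply: filterS => i /=;
  have [d0 _ _] := Nm i.
  by move/d0; exact.
by move=> xy; apply/d0.
Qed.

Lemma seq_in_finterp (M : forall i, prestructure R L (V i)) f
    (x : 'I_(farity f) -> forall i, V i) : (forall i, is_structure (M i)) ->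
  (forall k, seq_in M (x k)) ->
  seq_in M (fun i => finterp (M i) (fun k => x k i)).
Proof.
move=> Ms Mx i; have [_ _ _ Mf _] := Ms i.
by apply: (Mf _ _ _).1 => k; exact: Mx.
Qed.

Lemma uprod_tupleP (M : forall i, prestructure R L (V i)) n
    (a : 'I_n -> set (forall i, V i)) :
  tuple_in (uclass U N @` seq_in M) a ->
  exists2 x, forall k, seq_in M (x k) & a = (fun k => [u x k]).
Proof.
move=> Ma.
have /choice[x xP] : forall k, exists x, seq_in M x /\ [u x] = a k.
  by move=> k; have [x Mx <-] := Ma k; exists x.
by exists x => [k|]; [case: (xP k)|apply/funext => k; case: (xP k)].
Qed.

(** A Cauchy sequence of classes has representatives that are Cauchy at almost every index; the
    coordinatewise limits represent its limit. *)
Lemma uprod_sub_complete (M : forall i, prestructure R L (V i)) :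
  (forall i, dom (M i) `<=` dom (N i)) ->
  (forall i, complete_on (dom (M i)) (dist (N i))) ->
  complete_on (uclass U N @` seq_in M) (dist N').
Proof.
move=> MN Mc a Ma aC.
have /choice[x xP] : forall n, exists x, seq_in M x /\ [u x] = a n.
  by move=> n; have [x Mx <-] := Ma n; exists x.
have Mx n : seq_in M (x n) by case: (xP n).
have aE n : a n = [u x n] by case: (xP n).
have Nx n : seq_in N (x n) by move=> i; exact/MN/Mx.
(* At a good index all distances between terms agree with those in the ultraproduct; these are
   countably many conditions. *)
pose G i := forall mn : nat * nat,
  dist (N i) (x mn.1 i) (x mn.2 i) = dist N' (a mn.1) (a mn.2).
have Ux : U [set i | G i].
  apply: (usmall_prod UU Unat Unat) => -[m n] /=; rewrite !aE.
  exact: uprod_dist_ae.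
have /dep_choice[l lP] : forall i, exists l, dom (M i) l /\ (G i ->
     forall e : R, 0 < e -> exists n0 : nat,
       forall n, (n0 <= n)%N -> dist (N i) (x n i) l < e).
  (* The first term is an arbitrary value in [M i] at the other indices. *)
  move=> i; have [Gi|nG] := pselect (G i); last by exists (x 0%N i); split => //; exact: Mx.
  have [|e e0|l Ml xl] := Mc i (fun n => x n i); first by move=> n; exact: Mx.
    have [n0 n0P] := aC e e0; exists n0 => m n nm nn.
    by have /= -> := Gi (m, n); exact: n0P.
  by exists l.
have Ml : seq_in M l by move=> i; case: (lP i).
have Nl : seq_in N l by move=> i; exact/MN/Ml.
exists [u l]; first by exists l.
move=> e e0; have e20 : 0 < e / 2 by lra.
have [n0 n0P] := aC _ e20; exists n0 => n n0n.
have [i [Gi di]] := filter_ex (filterI Ux (uprod_dist_ae (Nx n) Nl)).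
rewrite aE -di; have [_ /(_ Gi)/(_ _ e20)[n1 n1P]] := lP i.
have := n1P _ (leq_maxr n0 n1); have := n0P n _ n0n (leq_maxl n0 n1).
have /= <- := Gi (n, maxn n0 n1).
have := metric_on_triangle (Nm i) (Nx n i) (Nx (maxn n0 n1) i) (Nl i); lra.
Qed.

Lemma uprod_metric : metric_on (dom N') (dist N').
Proof.
split.
- move=> _ _ [x Nx <-] [y Ny <-].
  rewrite (uclass_eqP Nx Ny); split=> [xy|xy].
    apply: filterS (uprod_dist_ae Nx Ny) => i; rewrite /mkset xy.
    by have [d0 _ _] := Nm i; move/d0; apply.
  have [i [/= <- /= xyi]] := filter_ex (filterI (uprod_dist_ae Nx Ny) xy).
  by have [d0 _ _] := Nm i; apply/d0.
- move=> _ _ [x Nx <-] [y Ny <-].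
  have [i [/= <- /= <-]] := filter_ex (filterI (uprod_dist_ae Nx Ny) (uprod_dist_ae Ny Nx)).
  exact: metric_onC.
- move=> _ _ _ [x Nx <-] [y Ny <-] [z Nz <-].
  have [i [/= <- [/= <- /= <-]]] := filter_ex (filterI (uprod_dist_ae Nx Nz)
    (filterI (uprod_dist_ae Nx Ny) (uprod_dist_ae Ny Nz))).
  exact: metric_on_triangle.
Qed.

(* A modulus of the form 1/(m+1) can be taken constant on a set in U. *)
Lemma ae_modulus (Q : forall i, R -> Prop) :
  (forall i r s, s <= r -> Q i r -> Q i s) ->
  (forall i, exists2 r : R, 0 < r & Q i r) -> exists2 r : R, 0 < r & U [set i | Q i r].
Proof.
move=> Qle Qex.
have /choice[m mP] : forall i, exists m : nat, Q i m.+1%:R^-1.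
  move=> i; have [r r0 Qr] := Qex i; have [m mr] := invSn_lt r0.
  by exists m; apply: Qle Qr; exact/ltW/mr.
have [m0 Um] := usmall_pigeonhole UU m Unat.
exists m0.+1%:R^-1; first by rewrite invr_gt0.
by apply: filterS Um => i /= <-.
Qed.

(** Continuity passes to the ultraproduct because [ae_modulus] makes one radius valid at almost
    every index. *)
Lemma uprod_structure : is_structure N'.
Proof.
split.
- have /dep_choice[x Nx] : forall i, exists x, dom (N i) x.
    by move=> i; have [[x Nx] _ _ _ _] := Nstr i; exists x.
  by exists [u x], x.
- exact: uprod_metric.
- apply: (@uprod_sub_complete N) => [i x|i] //.
  by have [_ _ Nc _ _] := Nstr i.
- move=> f a Na; have [x Nx ->] := @uprod_tupleP N _ _ Na.
  rewrite (uprod_finterpE UU Uc kinf Nstr Nx); split.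
    by exists (fun i => finterp (N i) (fun k => x k i)) => //; exact: seq_in_finterp.
  move=> e e0.
  have [|i|r r0 Ur] := @ae_modulus (fun i r => forall y, tuple_in (dom (N i)) y ->
      (forall k, dist (N i) (x k i) (y k) < r) ->
      dist (N i) (finterp (N i) (fun k => x k i)) (finterp (N i) y) < e).
  + by move=> i r s sr h y Ny xy; apply: h => // k; exact: lt_le_trans (xy k) sr.
  + have [_ _ _ Nf _] := Nstr i.
    by have [|_ /(_ _ e0)] := Nf f (fun k => x k i); first by move=> k; exact: Nx.
  exists r => // b Nb; have [y Ny ->] := @uprod_tupleP N _ _ Nb => xy.
  rewrite (uprod_finterpE UU Uc kinf Nstr Ny).
  have Uxy : U [set i | forall k, dist (N i) (x k i) (y k i) = dist N' [u x k] [u y k]].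
    by apply: filter_forall => k; exact: uprod_dist_ae.
  have Ud := uprod_dist_ae (seq_in_finterp Nstr Nx) (seq_in_finterp Nstr Ny).
  have [i [/= h [/= xyi <-]]] := filter_ex (filterI Ur (filterI Uxy Ud)).
  by apply: h => [k|k]; [exact: Ny|rewrite xyi; exact: xy].
- move=> p a Na; have [x Nx ->] := @uprod_tupleP N _ _ Na; move=> e e0.
  have [|i|r r0 Ur] := @ae_modulus (fun i r => forall y, tuple_in (dom (N i)) y ->
      (forall k, dist (N i) (x k i) (y k) < r) ->
      `|pinterp (N i) (fun k => x k i) - pinterp (N i) y| < e).
  + by move=> i r s sr h y Ny xy; apply: h => // k; exact: lt_le_trans (xy k) sr.
  + have [_ _ _ _ Np] := Nstr i.
    by apply: Np => // k; exact: Nx.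
  exists r => // b Nb; have [y Ny ->] := @uprod_tupleP N _ _ Nb => xy.
  have Uxy : U [set i | forall k, dist (N i) (x k i) (y k i) = dist N' [u x k] [u y k]].
    by apply: filter_forall => k; exact: uprod_dist_ae.
  have [i [/= h [/= xyi [/= <- /= <-]]]] := filter_ex (filterI Ur (filterI Uxy
    (filterI (uprod_pinterp_ae Nx) (uprod_pinterp_ae Ny)))).
  by apply: h => [k|k]; [exact: Ny|rewrite xyi; exact: xy].
Qed.

Section Substructures.
Variable M : forall i, prestructure R L (V i).
Hypothesis Mstr : forall i, is_structure (M i).
Hypothesis MN : forall i, substructure (M i) (N i).

Lemma seq_in_sub x : seq_in M x -> seq_in N x.
Proof. by move=> Mx i; have [+ _ _ _] := MN i; apply. Qed.

Lemma uprod_sub_dom : dom (uprod_sub U M N) `<=` dom N'.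
Proof. by move=> _ [x Mx <-]; exists x => //; exact: seq_in_sub. Qed.

Lemma uprod_sub_finterpE f (x : 'I_(farity f) -> forall i, V i) :
  (forall k, seq_in M (x k)) ->
  finterp N' (fun k => [u x k]) = [u (fun i => finterp (M i) (fun k => x k i))].
Proof.
move=> Mx; rewrite (uprod_finterpE UU Uc kinf Nstr); last by move=> k; exact: seq_in_sub.
congr (uclass U N _); apply: functional_extensionality_dep => i.
by have [_ _ fE _] := MN i; rewrite fE// => k; exact: Mx.
Qed.

Lemma uprod_sub_structure : is_structure (uprod_sub U M N).
Proof.
apply: (substr_on_structure uprod_structure) => //.
- exact: uprod_sub_dom.
- have /dep_choice[x Mx] : forall i, exists x, dom (M i) x.
    by move=> i; have [[x Mx] _ _ _ _] := Mstr i; exists x.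
  by exists [u x], x.
- apply: uprod_sub_complete => i; [by have [] := MN i|exact: substructure_complete].
- move=> f a Ma; have [x Mx ->] := @uprod_tupleP M _ _ Ma; rewrite uprod_sub_finterpE//.
  by exists (fun i => finterp (M i) (fun k => x k i)) => //; exact: seq_in_finterp.
Qed.

(** Choose at each index a label in [Q] close to the coordinate; by the pigeonhole principle this
    label is constant on a set in [U]. *)
Lemma uprod_sub_dense T (Q : set T) (e : forall i, T -> V i) : usmall U T ->
  (forall i t, dom (N i) (e i t)) ->
  (forall i x, dom (M i) x -> forall r : R, 0 < r ->
    exists2 t, Q t & dist (N i) x (e i t) < r) ->
  forall a, dom (uprod_sub U M N) a -> forall r : R, 0 < r ->
    exists2 t, Q t & dist N' a [u (fun i => e i t)] < r.
Proof.
move=> Ts eN ed _ [x Mx <-] r r0.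
have /choice[c cP] : forall i, exists t, Q t /\ dist (N i) (x i) (e i t) < r.
  by move=> i; have [t] := ed i _ (Mx i) _ r0; exists t.
have [t Ut] := usmall_pigeonhole UU c Ts.
have Nx := seq_in_sub Mx; have Ne : seq_in N (fun i => e i t) by move=> i.
have [i [di ct]] := filter_ex (filterI (uprod_dist_ae Nx Ne) Ut).
rewrite /mkset in di ct; have [] := cP i; rewrite ct => Qt xt.
by exists t => //; rewrite -di.
Qed.

End Substructures.

(* same_enum is a conjunction of conditions indexed by usmall types. *)
Lemma uprod_same_enum_ae (M : forall i, prestructure R L (V i)) T
    (e : forall i, T -> V i) :
  usmall U T -> usmall U (Defs.fsym L) -> usmall U (psym L) ->
  (forall i, is_structure (M i)) -> (forall i, substructure (M i) (N i)) ->
  (forall i t, dom (M i) (e i t)) ->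
  U [set i | same_enum (M i) (uprod_sub U M N) (e i)
                       (fun t => [u (fun i => e i t)])].
Proof.
move=> Ts Fs Ps Mstr MN Me.
have NM := seq_in_sub MN.
have Ne t : seq_in M (fun i => e i t) by move=> i.
have U1 : U [set i | forall s t, dist (M i) (e i s) (e i t) =
    dist N' [u (fun i => e i s)] [u (fun i => e i t)]].
  apply: (Ts (fun s => [set i | forall t, _])) => s; apply: Ts => t.
  apply: filterS (uprod_dist_ae (NM _ (Ne s)) (NM _ (Ne t))) => i; rewrite /mkset => <-.
  by have [_ dE _ _] := MN i; exact: dE.
have U2 : U [set i | forall f (s : 'I_(farity f) -> T) t,
    dist (M i) (finterp (M i) (e i \o s)) (e i t) =
    dist N' (finterp N' (fun k => [u (fun i => e i (s k))])) [u (fun i => e i t)]].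
  apply: (Fs (fun f => [set i | forall (s : 'I_(farity f) -> T) t, _])) => f.
  apply: (usmall_tuple UU Ts (A := fun s => [set i | forall t, _])) => s.
  apply: Ts => t; have Ms k : seq_in M (fun i => e i (s k)) by [].
  rewrite (uprod_sub_finterpE MN Ms); have Mf := seq_in_finterp Mstr Ms.
  apply: filterS (uprod_dist_ae (NM _ Mf) (NM _ (Ne t))) => i; rewrite /mkset => <-.
  have [_ dE _ _] := MN i; exact: dE (Mf i) (Ne t i).
have U3 : U [set i | forall p (s : 'I_(parity p) -> T),
    pinterp (M i) (e i \o s) = pinterp N' (fun k => [u (fun i => e i (s k))])].
  apply: (Ps (fun p => [set i | forall s : 'I_(parity p) -> T, _])) => p.
  apply: usmall_tuple => // s.
  have Ms k : seq_in N (fun i => e i (s k)) by exact: NM.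
  apply: filterS (uprod_pinterp_ae Ms) => i; rewrite /mkset => <-.
  by have [_ _ _ pE] := MN i; apply: pE => k; exact: Me.
by apply: filterS (filterI U1 (filterI U2 U3)) => i [h1 [h2 h3]]; split.
Qed.

End UltraproductStructure.

(** * Loewenheim-Skolem hulls with an enumerated dense subset *)

Lemma isomorphism_sub (R : realType) (L : language) (V W : Type)
    (A A' : prestructure R L V) (B' : prestructure R L W) (Z : set W) h :
  substructure A A' -> isomorphism A' B' h -> set_bij (dom A) Z h ->
  isomorphism A (substr_on B' Z) h.
Proof.
move=> [AA' dE fE pE] [_ hd hf hp] hZ; split=> //=.
- by move=> x y Ax Ay; rewrite dE//; apply: hd; exact: AA'.
- by move=> f x Ax; rewrite fE//; apply: hf => k; exact: AA'.
- by move=> p x Ax; rewrite pE//; apply: hp => k; exact: AA'.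
Qed.

Lemma card_le_enum (T V : Type) (A : set V) : (A #<= [set: T])%card ->
  A !=set0 -> exists2 g : T -> V, forall t, A (g t) & A `<=` range g.
Proof.
move=> /pfcard_geP[->[]//|[g] _]; exists g; first by move=> t; exact: (@funS _ _ _ _ g).
exact: (@surj _ _ _ _ g).
Qed.

Section LowenheimSkolem.
Variables (R : realType) (L : language) (K : MAEC R L).

(** The range of [e] is dense in its own closure, so its density character is at most the
    cardinality of [T]; hence [T + LS K] enumerates a dense subset of the hull. *)
Lemma LS_hull (V T : Type) (N : prestructure R L V) (e : T -> V) :
  inhabited T -> inK K N -> (forall t, dom N (e t)) ->
  exists D, [/\ prec K D N, forall t, dom D (e t) &
    exists e' : T + LS K -> V, dense_enum D e'].
Proof.
move=> [t0] NK eN; have eN' : range e `<=` dom N by move=> _ [t _ <-].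
have [_ Nm _ _ _] := inK_structure NK.
have [D [DK eD DN [E [S [[[Ecl clE] _] [[_ clS] Smin] ES]]]]] := downward_LS NK eN'.
have [[x0 Dx0] _ _ _ _] := inK_structure DK; have [DsubN dE _ _] := prec_sub DN.
have Dc := substructure_complete (inK_structure DK) (prec_sub DN).
have ED : E `<=` dom D.
  by apply: subset_trans Ecl _; exact: complete_closed Dc.
have [s sS] : exists s : T -> set_type S, forall x, exists t, s t = x.
  have ST : ([set: S] #<= [set: T])%card.
    rewrite (card_le_eql (card_setT S)).
    apply: card_le_trans (card_image_le e setT).
    by apply: Smin; split=> //; exact: subset_closure_in.
  have [x Sx] : S !=set0.
    have [|_ /(_ 1 ltr01)[x Sx _]] := clS (e t0); last by exists x.
    by apply: subset_closure_in => //; exists t0.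
  have [|s _ sT] := card_le_enum ST; first by exists (SigSub (mem_set Sx)).
  by exists s => y; have [t _ ty] := sT y Logic.I; exists t.
have E0 : E !=set0.
  have [|_ /(_ 1 ltr01)[x Ex _]] := clE x0; last by exists x.
  exact: subset_closure_in.
have [q qE Eq] := card_le_enum ES E0.
exists D; split=> // [t|]; first by apply: eD; exists t.
(* [q] enumerates [E] by [S + LS K], and [s] maps [T] onto [S]. *)
exists (fun u => match u with inl t => q (inl (s t)) | inr l => q (inr l) end).
split=> [[t|l]|x Dx]; [exact/ED/qE|exact/ED/qE|split=> // r r0].
have [|_ /(_ _ r0)[y Ey xy]] := clE x; first exact: subset_closure_in.
exists y; last by rewrite dE//; exact: ED.
by have [[z|l] _ <-] := Eq _ Ey; [have [t <-] := sS z; exists (inl t)|exists (inr l)].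
Qed.

End LowenheimSkolem.

(** * Ultraproducts of small families, and their directed unions *)

Section UltraproductsInClass.
Variables (R : realType) (L : language) (K : MAEC R L).
Variables (I : Type) (U : set_system I) (UU : UltraFilter U).
Variable Uc : succ_complete (LS K) U.
Variables (V : I -> Type) (N : forall i, prestructure R L (V i)).
Hypothesis NK : forall i, inK K (N i).
Local Notation "[ 'u' x ]" := (uclass U N x) (at level 0, x at level 99).
Local Notation N' := (uprod U N).
Implicit Types D M : forall i, prestructure R L (V i).

Let kinf : infinite_set [set: LS K] := @LS_infinite R L K.
Let Nstr i : is_structure (N i) := inK_structure (NK i).

Definition small_family D : Prop :=
  exists T (e : forall i, T -> V i), usmall U T /\ forall i, dense_enum (D i) (e i).

Lemma usmall_LS : usmall U (LS K).
Proof. exact: (usmall_card_le UU Uc (card_lexx _)). Qed.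

Lemma usmall_fsym : usmall U (Defs.fsym L).
Proof.
have H := usmall_card_le UU Uc (LS_language K) => A UA.
pose B (t : Defs.fsym L + psym L) : set I := if t is inl f then A f else setT.
have UB t : U (B t) by case: t => [f|p]; [exact: UA|exact: filterT].
by apply: filterS (H B UB) => i Bi f; exact: (Bi (inl f)).
Qed.

Lemma usmall_psym : usmall U (psym L).
Proof.
have H := usmall_card_le UU Uc (LS_language K) => A UA.
pose B (t : Defs.fsym L + psym L) : set I := if t is inr p then A p else setT.
have UB t : U (B t) by case: t => [f|p]; [exact: filterT|exact: UA].
by apply: filterS (H B UB) => i Bi p; exact: (Bi (inr p)).
Qed.

(* The pair (uprod_sub D N, uprod_sub D' N) is isomorphic to (D i, D' i) for
   almost every i. *)
Lemma uprod_sub_prec D D' :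
  (forall i, prec K (D i) (D' i)) -> (forall i, prec K (D' i) (N i)) ->
  small_family D -> small_family D' ->
  prec K (uprod_sub U D N) (uprod_sub U D' N).
Proof.
move=> DD' D'N [T [e [Ts eD]]] [T' [e' [Ts' eD']]].
have Ds i : is_structure (D i) by have [/inK_structure] := prec_inK (DD' i).
have Ds' i : is_structure (D' i) by have [/inK_structure] := prec_inK (D'N i).
have subDD' i := prec_sub (DD' i); have subD'N i := prec_sub (D'N i).
have DN i : prec K (D i) (N i) by exact: prec_trans (DD' i) (D'N i).
have subDN i := prec_sub (DN i).
(* [c i] enumerates a dense subset of [D' i] whose left half is dense in [D i], so a single
   isomorphism handles both structures. *)
pose c i (t : T + T') := match t with inl t => e i t | inr t => e' i t end.
have cD' i t : dom (D' i) (c i t).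
  case: t => t /=; last exact: (eD' i).1.
  by have [+ _ _ _] := subDD' i; apply; exact: (eD i).1.
have cN i t : dom (N i) (c i t).
  by have [+ _ _ _] := subD'N i; apply; exact: cD'.
have Tc : usmall U (T + T') by exact: usmall_sum.
pose cU t := [u (fun i => c i t)].
have cd i : dense_enum (D' i) (c i).
  split=> // x D'x; split=> // r r0; have [t xt] := enum_near (eD' i) D'x r0.
  by exists (e' i t) => //; exists (inr t).
have D's := uprod_sub_structure UU Uc kinf Nstr Ds' subD'N.
have [_ D'm _ _ _] := D's.
have Uc_sub t : dom (uprod_sub U D' N) (cU t) by exists (fun i => c i t).
have cUd : dense_enum (uprod_sub U D' N) cU.
  split=> // a D'a; split=> // r r0.
  have [| |t _ at_] := uprod_sub_dense UU Uc kinf Nstr subD'N (Q := setT)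
    (e := c) Tc _ _ D'a r0.
  - exact: cN.
  - move=> i x D'x q q0; have [t xt] := enum_near (cd i) D'x q0.
    exists t => //; have [_ <- // _ _] := subD'N i.
  - by exists (cU t) => //; exists t.
have [i ci] := filter_ex (uprod_same_enum_ae UU Uc kinf Nstr Tc usmall_fsym usmall_psym
  Ds' subD'N cD').
have [h hiso hQ] := same_enum_isomorphism (Ds' i) D's (cd i) cUd ci.
have {hQ} := hQ (range inl).
(* The closures of the left halves recover the smaller structures on both sides, so [h] maps one
   onto the other. *)
have -> : closure_in (dom (D' i)) (dist (D' i)) (c i @` range inl) = dom (D i).
  have [DsubD' dE _ _] := subDD' i; have [_ D'im _ _ _] := Ds' i.
  apply/seteqP; split.
    apply: subset_trans (complete_closed D'im DsubD' (substructure_complete (Ds i) (subDD' i))).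
    apply: closure_inS => _ [_ [t _ <-] <-]; exact: (eD i).1.
  move=> x Dx; split=> [|r r0]; first exact: DsubD'.
  have [t xt] := enum_near (eD i) Dx r0.
  exists (e i t); first by exists (inl t) => //; exists t.
  by rewrite -dE//; exact: (eD i).1.
have -> : closure_in (dom (uprod_sub U D' N)) (dist (uprod_sub U D' N)) (cU @` range inl) =
    dom (uprod_sub U D N).
  have DD'U : dom (uprod_sub U D N) `<=` dom (uprod_sub U D' N).
    move=> _ [x Dx <-]; exists x => // j.
    by have [+ _ _ _] := subDD' j; apply; exact: Dx.
  apply/seteqP; split.
    have [_ _ Dc _ _] := uprod_sub_structure UU Uc kinf Nstr Ds subDN.
    apply: subset_trans (complete_closed D'm DD'U Dc).
    apply: closure_inS => _ [_ [t _ <-] <-].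
    by exists (fun i => e i t) => // j; exact: (eD j).1.
  move=> a Da; split=> [|r r0]; first exact: DD'U.
  have [| |t [t' _ <-] at_] := uprod_sub_dense UU Uc kinf Nstr subDN (Q := range inl)
    (e := c) Tc _ _ Da r0.
  - exact: cN.
  - move=> j x Dx q q0; have [t xt] := enum_near (eD j) Dx q0.
    exists (inl t); first by exists t.
    by have [_ dE _ _] := subDN j; rewrite /= -dE//; exact: (eD j).1.
  - by exists (cU (inl t')) => //; exists (inl t') => //; exists t'.
move=> hbij; apply: (prec_iso (h := h)) (DD' i) => //.
exact: (isomorphism_sub (subDD' i) hiso hbij).
Qed.

Lemma small_family_hull M T (e : forall i, T -> V i) :
  (forall i, inK K (M i)) -> usmall U T -> inhabited T ->
  (forall i t, dom (M i) (e i t)) ->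
  exists D, [/\ forall i, prec K (D i) (M i), small_family D &
    forall i t, dom (D i) (e i t)].
Proof.
move=> MK Ts T0 eM.
have /dep_choice[D DP] : forall i, exists d, [/\ prec K d (M i),
    forall t, dom d (e i t) & exists e' : T + LS K -> V i, dense_enum d e'].
  by move=> i; exact: LS_hull.
have /dep_choice[e' eP] : forall i, exists e' : T + LS K -> V i, dense_enum (D i) e'.
  by move=> i; have [] := DP i.
exists D; split=> [i||i]; [by have [] := DP i| |by have [] := DP i].
exists (T + LS K)%type, e'; split=> //; apply: usmall_sum => //; exact: usmall_LS.
Qed.

Definition small_sub M : Type :=
  {D | (forall i, prec K (D i) (M i)) /\ small_family D}.

(** The ultraproducts of the small families below [M] form a directed system whose union is all of
    [uprod_sub U M N], so [directed_lub] applies. *)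
Lemma uprod_sub_lub M : (forall i, prec K (M i) (N i)) ->
  prec_lub K N' setT
    (fun D : small_sub M => dom (uprod_sub U (sval D) N))
    (dom (uprod_sub U M N)).
Proof.
move=> MN; set J := small_sub M; set X := fun D : J => _.
have MK i : inK K (M i) by have [] := prec_inK (MN i).
have subMN i := prec_sub (MN i).
have Ms i := inK_structure (MK i).
have DM (D : J) i : prec K (sval D i) (M i) by case: D => D [].
have DN (D : J) i : prec K (sval D i) (N i) by exact: prec_trans (DM D i) (MN i).
have XE : \bigcup_D X D = dom (uprod_sub U M N).
  apply/seteqP; split=> [_ [D _ [x Dx <-]]|_ [x Mx <-]].
    by exists x => // i; have [+ _ _ _] := prec_sub (DM D i); apply; exact: Dx.
  (* A hull of the single sequence [x], enumerated with one label, is a small family containing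
     it. *)
  have [| |i _|D [DM' Dsm Dx]] := @small_family_hull M unit (fun i _ => x i) MK.
  - by move=> A UA; apply: filterS (UA tt) => i Ai [].
  - by constructor.
  - exact: Mx.
  by exists (exist _ D (conj DM' Dsm)) => //; exists x => // i; exact: (Dx i tt).
rewrite -XE.
apply: (@directed_lub _ _ _ _ N' (uprod_structure UU Uc kinf Nstr) J
  (fun D D' : J => forall i, dom (sval D i) `<=` dom (sval D' i)) X).
- by move=> D; apply: uprod_sub_dom => i; exact: prec_sub (DN D i).
- move=> D D' DD'; apply: uprod_sub_prec;
    [|exact: DN|by case: (D) => ? []|by case: (D') => ? []].
  (* Both structures are strong in [N i], so inclusion of universes gives inclusion of structures,
     and coherence makes it strong. *)
  move=> i; apply: coherence (DN D' i) (DN D i).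
  have [_ d1 f1 p1] := prec_sub (DN D i); have [_ d2 f2 p2] := prec_sub (DN D' i).
  split=> //.
  + by move=> x y Dx Dy; rewrite d1// d2//; exact: DD'.
  + by move=> f x Dx; rewrite f1// f2// => k; exact: DD'.
  + by move=> p x Dx; rewrite p1// p2// => k; exact: DD'.
- by move=> D i.
- have [x Mx] : seq_in M !=set0.
    have /dep_choice[x Mx] : forall i, exists x, dom (M i) x; last by exists x.
    by move=> i; have [[x Mx] _ _ _ _] := Ms i; exists x.
  have : dom (uprod_sub U M N) [u x] by exists x.
  by rewrite -XE => -[D _ _]; constructor.
- by move=> D D' D'' h h' i; exact: subset_trans (h i) (h' i).
- move=> D D'; have [T [e [Ts eD]]] : small_family (sval D) by case: (D) => ? [].
  have [T' [e' [Ts' eD']]] : small_family (sval D') by case: (D') => ? [].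
  pose c i (t : T + T') := match t with inl t => e i t | inr t => e' i t end.
  have T0 : inhabited (T + T').
    have [i _] := filter_ex (filterT : U setT).
    have [/inK_structure[[x Dx] _ _ _ _] _] := prec_inK (DM D i).
    by have [t _] := enum_near (eD i) Dx ltr01; constructor; left.
  have cM i t : dom (M i) (c i t).
    case: t => t /=.
    + by have [+ _ _ _] := prec_sub (DM D i); apply; exact: (eD i).1.
    + by have [+ _ _ _] := prec_sub (DM D' i); apply; exact: (eD' i).1.
  (* [E i] contains dense subsets of [D i] and [D' i] and is closed in [N i], so it contains
     both. *)
  have [E [EM Es Ec]] := small_family_hull MK (usmall_sum UU Ts Ts') T0 cM.
  have Estr i : is_structure (E i) by have [/inK_structure] := prec_inK (EM i).
  have EN i : substructure (E i) (N i) by apply: prec_sub; exact: prec_trans (EM i) (MN i).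
  have closed i x (d : prestructure R L (V i)) S (g : S -> V i) :
      prec K d (N i) -> dense_enum d g -> (forall s, dom (E i) (g s)) ->
      dom d x -> dom (E i) x.
    move=> /prec_sub[dN dE _ _] gd gE dx.
    have [_ Nm _ _ _] := Nstr i; have [EsubN _ _ _] := EN i.
    apply: (complete_closed Nm EsubN (substructure_complete (Estr i) (EN i))).
    split=> [|r r0]; first exact: dN.
    have [s xs] := enum_near gd dx r0; exists (g s) => //.
    by rewrite -dE//; exact: gd.1.
  exists (exist _ E (conj EM Es)) => i x Dx.
  + by apply: (closed i x _ _ (e i) (DN D i) (eD i)) => // t; exact: (Ec i (inl t)).
  + by apply: (closed i x _ _ (e' i) (DN D' i) (eD' i)) => // t; exact: (Ec i (inr t)).
- rewrite XE; have [_ _ Mc _ _] := uprod_sub_structure UU Uc kinf Nstr Ms subMN.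
  exact: Mc.
Qed.

End UltraproductsInClass.

(** A small family below [M] is also one below [N]. So the ultraproduct of [N] bounds all those
    below [M], and [uprod_sub U M N] is their least upper bound. *)
Lemma uprod_prec (R : realType) (L : language) (K : MAEC R L)
    (I : Type) (U : set_system I) (UU : UltraFilter U)
    (Uc : succ_complete (LS K) U) (V : I -> Type)
    (M N : forall i, prestructure R L (V i)) :
  (forall i, prec K (M i) (N i)) -> prec K (uprod_sub U M N) (uprod U N).
Proof.
move=> MN; have NK i : inK K (N i) by have [] := prec_inK (MN i).
have NN i : prec K (N i) (N i) by exact: prec_refl.
have [_ _ Mlub] := uprod_sub_lub UU Uc NK MN.
have [_ Nub _] := uprod_sub_lub UU Uc NK NN.
apply: (Mlub (dom (uprod U N))) => // -[D [DM Ds]] _.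
by apply: (Nub (exist _ D (conj _ Ds))) => // i; exact: prec_trans (DM i) (MN i).
Qed.

(** * The map induced on ultraproducts *)

Section InducedMap.
Variables (R : realType) (L : language) (I : Type) (U : set_system I).
Variables (UU : UltraFilter U) (kappa : Type) (Uc : succ_complete kappa U).
Hypothesis kinf : infinite_set [set: kappa].
Variables (V W : I -> Type).
Variables (M : forall i, prestructure R L (V i)) (N M' : forall i, prestructure R L (W i)).
Variable h : forall i, V i -> W i.
Hypothesis Mstr : forall i, is_structure (M i).
Hypothesis Nstr : forall i, is_structure (N i).
Hypothesis MN : forall i, substructure (M' i) (N i).
Hypothesis hiso : forall i, isomorphism (M i) (M' i) (@h i).

(** The maps [h i] are injective, so almost everywhere equality is preserved in both directions. The
    intermediate [M'] lets one statement serve isomorphisms ([M'] equal to [N]), inclusions and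
    embeddings. *)
Lemma induced_map_isomorphism :
  exists2 H, induced_map U M N h H & isomorphism (uprod U M) (uprod_sub U M' N) H.
Proof.
pose hx (x : forall i, V i) : forall i, W i := fun i => @h i (x i).
have hM x : seq_in M x -> seq_in M' (hx x).
  by move=> Mx i; have [[+ _ _] _ _ _] := hiso i; apply; exact: Mx.
have hN x : seq_in M x -> seq_in N (hx x) by move=> /hM; exact: seq_in_sub.
have heq x y : seq_in M x -> seq_in M y ->
    U [set i | hx x i = hx y i] <-> U [set i | x i = y i].
  move=> Mx My; split; apply: filterS => i /=; last by rewrite /hx => ->.
  by have [[_ inj _] _ _ _] := hiso i; apply: inj; apply: mem_set.
(* The union of the classes of the images of all representatives; when [a] is a class, these all
   coincide. *)
pose H (a : set (forall i, V i)) : set (forall i, W i) :=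
  [set z | exists2 x, a x & uclass U N (hx x) z].
have HE x : seq_in M x -> H (uclass U M x) = uclass U N (hx x).
  move=> Mx; apply/seteqP; split=> [z [y xy yz]|z xz].
    have [My Uxy] := (uclassP UU Uc kinf Mstr y Mx).1 xy.
    suff -> : uclass U N (hx x) = uclass U N (hx y) by [].
    by apply/(uclass_eqP UU Uc kinf Nstr); [exact: hN|exact: hN|exact/heq].
  by exists x => //; exact: (uclass_refl UU Uc kinf Mstr).
exists H => //.
have dE := uprod_dist_ae UU Uc kinf.
split.
- split.
  + by move=> _ [x Mx <-]; rewrite HE//; exists (hx x) => //; exact: hM.
  + move=> _ _ /set_mem[x Mx <-] /set_mem[y My <-]; rewrite !HE//.
    move/(uclass_eqP UU Uc kinf Nstr (hN _ Mx) (hN _ My))/(heq _ _ Mx My).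
    by move/(uclass_eqP UU Uc kinf Mstr Mx My).
  + move=> _ [y M'y <-].
    have /dep_choice[x xP] : forall i, exists x, dom (M i) x /\ @h i x = y i.
      by move=> i; have [[_ _ /(_ _ (M'y i))[x Mx <-]] _ _ _] := hiso i; exists x.
    have Mx : seq_in M x by move=> i; case: (xP i).
    exists (uclass U M x); first by exists x.
    rewrite HE//; congr (uclass U N _); apply: functional_extensionality_dep => i.
    by case: (xP i).
- move=> _ _ [x Mx <-] [y My <-]; rewrite !HE//.
  have [i [di di']] := filter_ex (filterI (dE _ _ _ _ Mstr _ _ Mx My)
    (dE _ _ _ _ Nstr _ _ (hN _ Mx) (hN _ My))).
  rewrite /mkset in di di'; rewrite -[RHS]di -[LHS]di'.
  have [_ dMN _ _] := MN i; rewrite -(dMN _ _ (hM _ Mx i) (hM _ My i)).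
  by have [_ hd _ _] := hiso i; exact: hd (Mx i) (My i).
- move=> f a Ma; have [x Mx ->] := @uprod_tupleP _ _ _ U _ M M _ a Ma.
  rewrite (uprod_finterpE UU Uc kinf Mstr Mx) HE; last exact: seq_in_finterp.
  have -> : H \o (fun k => uclass U M (x k)) = (fun k => uclass U N (hx (x k))).
    by apply/funext => k /=; rewrite HE.
  rewrite [RHS](uprod_sub_finterpE UU Uc kinf Nstr MN (x := fun k => hx (x k))); last first.
    by move=> k; exact: hM.
  congr (uclass U N _); apply: functional_extensionality_dep => i.
  by have [_ _ hf _] := hiso i; apply: hf => k; exact: Mx.
- move=> p a Ma; have [x Mx ->] := @uprod_tupleP _ _ _ U _ M M _ a Ma.
  have -> : H \o (fun k => uclass U M (x k)) = (fun k => uclass U N (hx (x k))).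
    by apply/funext => k /=; rewrite HE.
  have Nx k : seq_in N (hx (x k)) by exact: hN.
  have [i [pi_ pi']] := filter_ex (filterI (uprod_pinterp_ae UU Uc kinf Mstr Mx)
    (uprod_pinterp_ae UU Uc kinf Nstr Nx)).
  rewrite /mkset in pi_ pi'; rewrite -[RHS]pi_ -[LHS]pi'.
  have [_ _ _ pMN] := MN i; rewrite -pMN; last by move=> k; exact: hM.
  by have [_ _ _ hp] := hiso i; apply: (hp p (fun k => x k i)) => k; exact: Mx.
Qed.

End InducedMap.

(** * Strong substructures, isomorphisms and embeddings of ultraproducts *)

Theorem mainTheorem2 (R : realType) (L : language) (K : MAEC R L)
    (I : Type) (U : set_system I) (UU : UltraFilter U)
    (Uc : succ_complete (LS K) U) :
  [/\ (forall (V : I -> Type) (M N : forall i, prestructure R L (V i)),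
        (forall i, inK K (M i)) -> (forall i, inK K (N i)) ->
        (forall i, prec K (M i) (N i)) ->
        exists2 H, induced_map U M N (fun i x => x) H &
          isomorphism (uprod U M) (uprod_sub U M N) H /\
          prec K (uprod_sub U M N) (uprod U N)),
      (forall (V W : I -> Type) (M : forall i, prestructure R L (V i))
          (N : forall i, prestructure R L (W i)) (h : forall i, V i -> W i),
        (forall i, inK K (M i)) -> (forall i, inK K (N i)) ->
        (forall i, isomorphism (M i) (N i) (h i)) ->
        exists2 H, induced_map U M N h H &
                   isomorphism (uprod U M) (uprod U N) H) &
      (forall (V W : I -> Type) (M : forall i, prestructure R L (V i))
          (N : forall i, prestructure R L (W i)) (h : forall i, V i -> W i),
        (forall i, inK K (M i)) -> (forall i, inK K (N i)) ->
        (forall i, K_embedding K (M i) (N i) (h i)) ->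
        exists2 H, induced_map U M N h H &
                   K_embedding K (uprod U M) (uprod U N) H)].
Proof.
have kinf := @LS_infinite R L K.
have str (V : I -> Type) (M : forall i, prestructure R L (V i)) :
  (forall i, inK K (M i)) -> forall i, is_structure (M i).
  by move=> MK i; exact: inK_structure (MK i).
split=> [V M N MK NK MN|V W M N h MK NK hiso|V W M N h MK NK hK].
(* A sequence in [M] may have different classes over [M] and over [N], so the inclusion is realised
   by the map induced by the identities. *)
- have [|H Hind Hiso] := induced_map_isomorphism UU Uc kinf (str _ _ MK) (str _ _ NK)
    (fun i => prec_sub (MN i)) (h := fun i x => x).
    by move=> i; split=> //; split=> // x Mx; exists x.
  by exists H => //; split=> //; exact: uprod_prec.
- by apply: (induced_map_isomorphism UU Uc kinf (str _ _ MK) (str _ _ NK)) hiso => i; split.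
(* The image of each embedding is a strong substructure [M' i] of [N i], which reduces the claim to
   an isomorphism followed by an inclusion. *)
- have /dep_choice[M' M'P] : forall i, exists M',
      prec K M' (N i) /\ isomorphism (M i) M' (h i).
    by move=> i; have [M'] := hK i; exists M'.
  have M'N i : prec K (M' i) (N i) by case: (M'P i).
  have [|H Hind Hiso] := induced_map_isomorphism UU Uc kinf (str _ _ MK) (str _ _ NK)
    (fun i => prec_sub (M'N i)) (h := h); first by move=> i; case: (M'P i).
  by exists H => //; exists (uprod_sub U M' N) => //; exact: uprod_prec.
Qed.
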